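(* Fix one of the tensor, free or Boolean independences, with associated universal product $\star$. Let $c(\pi;\sigma)\in\mathbb{C}$ ($\sigma\le\pi\in\mathcal{P}(n)$, $n\ge1$) be the universal coefficients of $\star$, and let $d(\pi)\in\mathbb{C}$ ($\pi\in\mathcal{P}(n)$, $n\ge1$) be coefficients such that $$\varphi(X_1\cdots X_n)=\sum_{\pi\in\mathcal{P}(n)}d(\pi)K_\pi(X_1,\dots,X_n)$$ for all algebraic probability spaces $(\mathcal{A},\varphi)$, all $n\geq 1$ and all $X_1,\dots,X_n\in\mathcal{A}$, where $K_n$ are the joint cumulants associated with the fixed independence. Then $d(\pi)=c(\pi;\pi)$ for every $\pi\in\mathcal{P}(n)$, $n\ge1$.
   Context: An algebraic probability space $(\mathcal{A},\varphi)$ is a unital $*$-algebra over $\mathbb{C}$ with a state $\varphi$. **Independence.** Let $\{\mathcal{A}_\lambda\}_{\lambda\in\Lambda}$ be $*$-subalgebras. The rules are required for all $n\ge2$, $X_i\in\mathcal{A}_{\lambda_i}$, $\lambda_i\ne\lambda_{i+1}$. Tensor: $\varphi(X_1\cdots X_n)=\prod_{\lambda}\varphi\big(\overrightarrow{\prod}_{i;\lambda_i=\lambda}X_i\big)$, with factors in the same order as in $X_1\cdots X_n$ (empty product $=1$). Free (all $\mathcal{A}_\lambda$ contain the unit of $\mathcal{A}$): $\varphi(X_1\cdots X_n)=0$ whenever $\varphi(X_1)=\cdots=\varphi(X_n)=0$. Boolean: $\varphi(X_1\cdots X_n)=\varphi(X_1)\cdots\varphi(X_n)$. **Dot operation and cumulants.**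 For the fixed independence take copies $X^{(j)}$, $j\ge1$, of each $X\in\mathcal{A}$ in an algebraic probability space $(\widetilde{\mathcal{A}},\widetilde\varphi)$ such that $X\mapsto X^{(j)}$ is a $*$-homomorphism, $\widetilde\varphi(X_1^{(j)}\cdots X_n^{(j)})=\varphi(X_1\cdots X_n)$, and the subalgebras $\{X^{(j)}\}_{X\in\mathcal{A}}$, $j\ge1$, are independent. Put $N.X=X^{(1)}+\cdots+X^{(N)}$, $0.X=0$, and write $\varphi$ for $\widetilde\varphi$. Then $\varphi(N.X_1\cdots N.X_n)$ is a polynomial in $N$ without constant term, and $K_n(X_1,\dots,X_n)$ is its coefficient of $N$ (these are the usual tensor, free, Boolean joint cumulants). **Partitions.** $\mathcal{P}(n)$ is the set of partitions of $\{1,\dots,n\}$; $\sigma\le\pi$ means every block of $\sigma$ is contained in a block of $\pi$. For $W=\{j_1<\cdots<j_k\}$, $X_W:=X_{j_1}\cdots X_{j_k}$ (and $K_k(X_W):=K_k(X_{j_1},\dots,X_{j_k})$); $K_\pi(X_1,\dots,X_n):=\prod_{V\in\pi}K_{|V|}(X_V)$. **Universal product and universal coefficients.** For a family $(\mathcal{A}_k,\varphi_k)$, the product $\star_k\varphi_k$ is the functional on the free product $\ast_k\mathcal{A}_k$ (units identified in the tensor and free cases, not identified in the Boolean case) which restricts to $\varphi_k$ on $\mathcal{A}_k$ and for which the $\mathcal{A}_k$ are independent in the fixed sense. These products are associative. For $\pi\in\mathcal{P}(n)$ write $X_1\cdots X_n\in\mathcal{A}_\pi$ when each $X_i$ is taken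 from one of the $\mathcal{A}_k$, with $X_i$ and $X_j$ taken from the same $\mathcal{A}_k$ if and only if $i$ and $j$ are in the same block of $\pi$. For $\sigma=\{W_1,\dots,W_m\}\le\pi$ let $k(l)$ be the index with $X_i\in\mathcal{A}_{k(l)}$ for $i\in W_l$, and put $\varphi^\sigma(X_1\cdots X_n):=\varphi_{k(1)}(X_{W_1})\cdots\varphi_{k(m)}(X_{W_m})$. The universal coefficients $c(\pi;\sigma)\in\mathbb{C}$, depending only on $\sigma\le\pi$, are those satisfying $$\varphi(X_1\cdots X_n)=\sum_{\sigma\le\pi}c(\pi;\sigma)\,\varphi^\sigma(X_1\cdots X_n)$$ for all $n\ge1$, $\pi\in\mathcal{P}(n)$, all families $(\mathcal{A}_k,\varphi_k)$ and all $X_1\cdots X_n\in\mathcal{A}_\pi$, where $\varphi=\varphi_{k_1}\star\cdots\star\varphi_{k_p}$ if $X_1\cdots X_n\in\ast_{i=1}^p\mathcal{A}_{k_i}$. The $c(\pi;\pi)$ are called the highest coefficients. *)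

(* Defs.v *)
From HB Require Import structures.
From mathcomp Require Import boolp classical_sets.
From mathcomp Require Import all_boot all_order all_algebra.
From mathcomp Require Export reals complex.

Set Implicit Arguments.
Unset Strict Implicit.
Unset Printing Implicit Defensive.

Import Order.TTheory GRing.Theory Num.Theory.
Local Open Scope ring_scope.

HB.mixin Record isStarAlgebra (C : numClosedFieldType) A
    of GRing.Algebra C A := {
  star : A -> A;
  starK : involutive star;
  starD : {morph star : x y / x + y};
  starM : forall x y, star (x * y) = star y * star x;
  starZ : forall (a : C) x, star (a *: x) = Num.conj a *: star x
}.

#[short(type="starAlgType")]
HB.structure Definition StarAlgebra (C : numClosedFieldType) :=
  {A of GRing.Algebra C A & isStarAlgebra C A}.

Inductive independence := Tensor | Free | Boolean.

Section Probability.
Variable C : numClosedFieldType.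

(* The order of [C] makes [0 <= z] mean that z is a nonnegative real. *)
Definition is_state (A : starAlgType C) (phi : A -> C) : Prop :=
  [/\ scalar phi, phi 1 = 1 & forall x, 0 <= phi (star x * x)].

Record probSpace := ProbSpace {
  ps_alg :> starAlgType C;
  ps_state : ps_alg -> C;
  ps_stateP : is_state ps_state
}.

(* A *-homomorphism, required to preserve the unit only if [unital]. *)
Definition is_star_hom (unital : bool) (A B : starAlgType C) (f : A -> B) :
    Prop :=
  [/\ linear f, {morph f : x y / x * y}, {morph f : x / star x}
    & unital -> f 1 = 1].

(* Not required to contain the unit. *)
Definition is_star_subalgebra (A : starAlgType C) (S : set A) : Prop :=
  [/\ S 0, forall (a : C) x y, S x -> S y -> S (a *: x + y),
      forall x y, S x -> S y -> S (x * y) & forall x, S x -> S (star x)].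

(* Products over ['I_n] in the noncommutative ring [A] are taken in increasing *)
(* order.  In the tensor rule, the labels that do not occur among the [lam i]  *)
(* contribute the empty product 1 and are left out.                            *)
Definition independence_rule (ty : independence) (A : starAlgType C)
    (phi : A -> C) (L : eqType) (n : nat) (lam : 'I_n -> L) (X : 'I_n -> A) :
    Prop :=
  match ty with
  | Tensor => phi (\prod_(i < n) X i) =
      \prod_(l <- undup (codom lam)) phi (\prod_(i < n | lam i == l) X i)
  | Free => (forall i, phi (X i) = 0) -> phi (\prod_(i < n) X i) = 0
  | Boolean => phi (\prod_(i < n) X i) = \prod_(i < n) phi (X i)
  end.

Definition independent (ty : independence) (A : starAlgType C) (phi : A -> C)
    (L : eqType) (S : L -> set A) : Prop :=
  [/\ forall l, is_star_subalgebra (S l),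
      ty = Free -> forall l, S l 1
    & forall (n : nat) (lam : 'I_n -> L) (X : 'I_n -> A),
        (2 <= n)%N ->
        (forall i, S (lam i) (X i)) ->
        (forall i j : 'I_n, j = i.+1 :> nat -> lam i != lam j) ->
        independence_rule ty phi lam X].

(* The copy written X^(j), j >= 1, is [cp_map j.-1 X]: indices start at 0. *)
Record copies (ty : independence) (A : probSpace) := Copies {
  cp_space : probSpace;
  cp_map : nat -> A -> cp_space;
  cp_hom : forall j, is_star_hom false (cp_map j);
  cp_moments : forall j (n : nat) (X : 'I_n -> A),
    ps_state (\prod_(i < n) cp_map j (X i)) = ps_state (\prod_(i < n) X i);
  cp_indep : independent ty (@ps_state cp_space) (fun j => range (cp_map j))
}.

Definition dot ty (A : probSpace) (E : copies ty A) (N : nat) (X : A) :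
    cp_space E :=
  \sum_(j < N) cp_map E j X.

(* The coefficient of N in the polynomial function                            *)
(* N |-> phi(N.X_1 ... N.X_n); the default 0 is only for totality.            *)
Definition cumulant ty (A : probSpace) (E : copies ty A) (n : nat)
    (X : 'I_n -> A) : C :=
  xget 0 (fun k : C => exists p : {poly C},
    (forall N : nat, ps_state (\prod_(i < n) dot E N (X i)) = p.[N%:R])
    /\ k = p`_1).

Definition is_partition (n : nat) (pi : {set {set 'I_n}}) : bool :=
  partition pi [set: 'I_n].

Definition refines (n : nat) (sigma pi : {set {set 'I_n}}) : bool :=
  [forall W in sigma, exists V in pi, W \subset V].

(* [enum_val] lists the elements of V in increasing order. *)
Definition cumulant_part ty (A : probSpace) (E : copies ty A) (n : nat)
    (pi : {set {set 'I_n}}) (X : 'I_n -> A) : C :=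
  \prod_(V in pi) cumulant E (fun i : 'I_#|V| => X (enum_val i)).

(* [unital = true]: coproduct of unital *-algebras, i.e. the free product with *)
(* units identified.                                                           *)
(* [unital = false]: the iota k and f k need not preserve units, so that B is  *)
(* the free product with units not identified, to which a new unit (the one of *)
(* B) has been adjoined; words of length >= 1 lie in the free product itself.  *)
Definition is_free_product (unital : bool) (I : finType) (A : I -> probSpace)
    (B : starAlgType C) (iota : forall k, A k -> B) : Prop :=
  (forall k, is_star_hom unital (iota k)) /\
  forall (D : starAlgType C) (f : forall k, A k -> D),
    (forall k, is_star_hom unital (f k)) ->
    exists! g : B -> D,
      is_star_hom true g /\ forall k x, g (iota k x) = f k x.

Definition units_identified (ty : independence) : bool :=
  if ty is Boolean then false else true.

Definition is_universal_product (ty : independence) (I : finType)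
    (A : I -> probSpace) (B : starAlgType C) (iota : forall k, A k -> B)
    (psi : B -> C) : Prop :=
  [/\ is_free_product (units_identified ty) iota,
      scalar psi,
      forall k x, psi (iota k x) = ps_state x
    & independent ty psi (fun k => range (@iota k))].

(* X_i is the element [tagged (X i)] of the algebra of index [tag (X i)]. *)
Definition in_blocks (I : finType) (A : I -> probSpace) (n : nat)
    (pi : {set {set 'I_n}}) (X : 'I_n -> {k : I & A k}) : Prop :=
  forall i j, (tag (X i) == tag (X j)) = (j \in pblock pi i).

(* phi_k(X_W), where k is the common index of the X_i, i in W, so that each    *)
(* [untag 1 id (X i)] below is X_i itself, as an element of [A k].             *)
Definition block_moment (I : finType) (A : I -> probSpace) (n : nat)
    (X : 'I_n -> {k : I & A k}) (W : {set 'I_n}) : C :=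
  if [pick i in W] is Some i0 then
    let k := tag (X i0) in
    @ps_state (A k) (\prod_(i in W) untag (1 : A k) id (X i))
  else 1.

Definition moment_part (I : finType) (A : I -> probSpace) (n : nat)
    (sigma : {set {set 'I_n}}) (X : 'I_n -> {k : I & A k}) : C :=
  \prod_(W in sigma) block_moment X W.

Definition universal_coefficients (ty : independence)
    (c : forall n, {set {set 'I_n}} -> {set {set 'I_n}} -> C) : Prop :=
  forall (n : nat) (pi : {set {set 'I_n}}), (1 <= n)%N -> is_partition pi ->
  forall (I : finType) (A : I -> probSpace) (B : starAlgType C)
    (iota : forall k, A k -> B) (psi : B -> C),
    is_universal_product ty iota psi ->
  forall X : 'I_n -> {k : I & A k}, in_blocks pi X ->
    psi (\prod_(i < n) iota (tag (X i)) (tagged (X i))) =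
    \sum_(sigma | is_partition sigma && refines sigma pi)
      c n pi sigma * moment_part sigma X.

Definition moment_cumulant_coefficients (ty : independence)
    (d : forall n, {set {set 'I_n}} -> C) : Prop :=
  forall (A : probSpace) (E : copies ty A) (n : nat) (X : 'I_n -> A),
    (1 <= n)%N ->
    ps_state (\prod_(i < n) X i) =
    \sum_(pi | is_partition pi) d n pi * cumulant_part E pi X.

End Probability.

(* Main.v *)
(* The coefficients are tested on elements that isolate the partition [pi].
   Attach to each block V of [pi] a copy of one space T, holding elements Y_i
   (i in V) with phi(prod_(i in W) Y_i) = 1 if W = V and 0 if 0 < |W| < |V|;
   cyclic matrix units e_(k,k+1) in a vector state do this.  Let D be the
   product of these copies, X_i the image of Y_i in D, and take independent
   copies D^(j) of D: by associativity, the copies of T indexed by pairs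
   (V, j) are independent.  In the universal expansion of a word in the
   X_i^(j), i in W, only the partition of W into blocks of [pi] can survive,
   and only if W is a union of blocks on each of which j is constant.  Hence
   phi(X_1 ... X_n) = c(pi;pi), while phi(prod_(i in W) N.X_i) is a constant
   multiple of N^b if W is a union of b blocks and is 0 otherwise.  So
   K(X_W) = 1 if W is a block and 0 if not, K_tau(X) = [tau = pi], and the
   moment-cumulant formula reduces to phi(X_1 ... X_n) = d(pi).
   All the spaces needed are algebras of row- and column-finite matrices over
   the points of a Fock-like space (words in the free and Boolean cases,
   occupation numbers in the tensor case), with the vacuum state. *)
From HB Require Import structures.
Require Import Defs.
From mathcomp Require Import boolp classical_sets.
From mathcomp Require Import all_boot all_order all_algebra.
From mathcomp Require Import reals complex.

Set Implicit Arguments.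
Unset Strict Implicit.
Unset Printing Implicit Defensive.

Import Order.TTheory GRing.Theory Num.Theory.
Local Open Scope ring_scope.
Local Open Scope quotient_scope.

(** * Coproducts of star-algebras *)

Section FreeProduct.
Variables (C : numClosedFieldType) (unital : bool).
Variables (I : finType) (A : I -> probSpace C).

(** Formal *-expressions in the elements of the [A k]; the free product is a quotient of them. Zero
    and opposites are obtained by scaling with 0 and -1. *)
Inductive starTerm : Type :=
| Gen k of A k
| One
| Add of starTerm & starTerm
| Mul of starTerm & starTerm
| Scale of C & starTerm
| Star of starTerm.

HB.instance Definition _ := gen_eqMixin starTerm.
HB.instance Definition _ := gen_choiceMixin starTerm.

Fixpoint eval (D : starAlgType C) (f : forall k, A k -> D) (t : starTerm) : D :=
  match t with
  | Gen k x => f k x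
  | One => 1
  | Add t1 t2 => eval f t1 + eval f t2
  | Mul t1 t2 => eval f t1 * eval f t2
  | Scale a t1 => a *: eval f t1
  | Star t1 => star (eval f t1)
  end.

Definition star_family (D : starAlgType C) (f : forall k, A k -> D) : Prop :=
  forall k, is_star_hom unital (f k).

(* Quantifying over all targets makes every star-algebra law hold in the
   quotient because it holds in each target. *)
Definition term_equiv (t s : starTerm) : bool :=
  `[< forall (D : starAlgType C) (f : forall k, A k -> D),
        star_family f -> eval f t = eval f s >].

Lemma term_equiv_equiv : equiv_class_of term_equiv.
Proof.
split=> [t | t s | s t u].
- exact/asboolP.
- by apply/asboolP/asboolP => E D f hf; rewrite E.
- by move=> /asboolP E1 /asboolP E2; apply/asboolP => D f hf; rewrite E1 ?E2.
Qed.

Canonical term_equiv_rel := EquivRelPack term_equiv_equiv.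

Definition representable : Prop :=
  exists (D : starAlgType C) (f : forall k, A k -> D), star_family f.

(* The zero ring is not an algebra in MathComp, so that the quotient is one
   only if the family maps to some *-algebra. *)
Definition starCoprod of representable := {eq_quot term_equiv}.

Section Structure.
Variable rep : representable.
Local Notation B := (starCoprod rep).

HB.instance Definition _ := Choice.on B.

Definition coprod_pi (t : starTerm) : B := \pi_{eq_quot term_equiv} t.
Definition coprod_repr (x : B) : starTerm := repr (x : {eq_quot term_equiv}).
Definition coprod_eval (D : starAlgType C) (f : forall k, A k ->
  D) (x : B) : D :=
  eval f (coprod_repr x).

Lemma coprod_eval_pi (D : starAlgType C) (f : forall k, A k -> D) t :
  star_family f -> coprod_eval f (coprod_pi t) = eval f t.
Proof.
move=> hf; rewrite /coprod_eval /coprod_repr /coprod_pi.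
have /eqquotP/asboolP/(_ D f hf) // :
  (repr (\pi_{eq_quot term_equiv} t) = t %[mod {eq_quot term_equiv}])%qT.
by rewrite reprK.
Qed.

Lemma coprod_reprK (x : B) : coprod_pi (coprod_repr x) = x.
Proof. exact: reprK. Qed.

(** Evaluations separate points because the quotient identifies exactly the terms that no evaluation
    distinguishes. Each algebra law in the quotient is then inherited from the targets. *)
Lemma coprod_ext (x y : B) :
  (forall (D : starAlgType C) (f : forall k, A k -> D), star_family f ->
     coprod_eval f x = coprod_eval f y) -> x = y.
Proof.
move=> E; rewrite -[x]coprod_reprK -[y]coprod_reprK.
by apply/eqquotP/asboolP.
Qed.

Definition coprod_add (x y : B) :=
  coprod_pi (Add (coprod_repr x) (coprod_repr y)).
Definition coprod_mul (x y : B) :=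
  coprod_pi (Mul (coprod_repr x) (coprod_repr y)).
Definition coprod_scale a (x : B) := coprod_pi (Scale a (coprod_repr x)).
Definition coprod_star (x : B) := coprod_pi (Star (coprod_repr x)).
Definition coprod_one : B := coprod_pi One.
Definition coprod_zero : B := coprod_pi (Scale 0 One).
Definition coprod_opp := coprod_scale (-1).

Section Eval.
Variables (D : starAlgType C) (f : forall k, A k -> D).
Hypothesis hf : star_family f.

Lemma coprod_evalD x y :
  coprod_eval f (coprod_add x y) = coprod_eval f x + coprod_eval f y.
Proof. by rewrite coprod_eval_pi. Qed.

Lemma coprod_evalM x y :
  coprod_eval f (coprod_mul x y) = coprod_eval f x * coprod_eval f y.
Proof. by rewrite coprod_eval_pi. Qed.

Lemma coprod_evalZ a x :
  coprod_eval f (coprod_scale a x) = a *: coprod_eval f x.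
Proof. by rewrite coprod_eval_pi. Qed.

Lemma coprod_eval_star x :
  coprod_eval f (coprod_star x) = star (coprod_eval f x).
Proof. by rewrite coprod_eval_pi. Qed.

Lemma coprod_eval1 : coprod_eval f coprod_one = 1.
Proof. by rewrite coprod_eval_pi. Qed.

Lemma coprod_eval0 : coprod_eval f coprod_zero = 0.
Proof. by rewrite coprod_eval_pi //= scale0r. Qed.

Lemma coprod_evalN x : coprod_eval f (coprod_opp x) = - coprod_eval f x.
Proof. by rewrite coprod_evalZ scaleN1r. Qed.

Definition coprod_evalE := (coprod_evalD, coprod_evalM, coprod_evalZ,
  coprod_eval_star, coprod_eval1, coprod_eval0, coprod_evalN).

End Eval.

Local Ltac by_eval lem :=
  let hf := fresh "hf" in
  apply: coprod_ext => ? ? hf; rewrite !(coprod_evalE hf); apply: lem.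

Fact coprod_addA : associative coprod_add.
Proof. by move=> x y z; by_eval addrA. Qed.
Fact coprod_addC : commutative coprod_add.
Proof. by move=> x y; by_eval addrC. Qed.
Fact coprod_add0 : left_id coprod_zero coprod_add.
Proof. by move=> x; by_eval add0r. Qed.
Fact coprod_addN : left_inverse coprod_zero coprod_opp coprod_add.
Proof. by move=> x; by_eval addNr. Qed.

HB.instance Definition _ :=
  GRing.isZmodule.Build B coprod_addA coprod_addC coprod_add0 coprod_addN.

Fact coprod_mulA : associative coprod_mul.
Proof. by move=> x y z; by_eval mulrA. Qed.
Fact coprod_mul1l : left_id coprod_one coprod_mul.
Proof. by move=> x; by_eval mul1r. Qed.
Fact coprod_mul1r : right_id coprod_one coprod_mul.
Proof. by move=> x; by_eval mulr1. Qed.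
Fact coprod_mulDl : left_distributive coprod_mul coprod_add.
Proof. by move=> x y z; by_eval mulrDl. Qed.
Fact coprod_mulDr : right_distributive coprod_mul coprod_add.
Proof. by move=> x y z; by_eval mulrDr. Qed.
Fact coprod_one_neq0 : coprod_one != coprod_zero.
Proof.
(* The target supplied by [rep] separates one from zero. *)
case: rep => D [f hf]; apply/eqP => /(congr1 (coprod_eval f)).
by rewrite !(coprod_evalE hf) => /eqP; rewrite oner_eq0.
Qed.

HB.instance Definition _ := GRing.Zmodule_isNzRing.Build B
  coprod_mulA coprod_mul1l coprod_mul1r coprod_mulDl coprod_mulDr
  coprod_one_neq0.

Fact coprod_scaleA a b x :
  coprod_scale a (coprod_scale b x) = coprod_scale (a * b) x.
Proof. by by_eval scalerA. Qed.
Fact coprod_scale1 : left_id 1 coprod_scale.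
Proof. by move=> x; by_eval scale1r. Qed.
Fact coprod_scaleDr : right_distributive coprod_scale +%R.
Proof. by move=> a x y; by_eval scalerDr. Qed.
Fact coprod_scaleDl x : {morph coprod_scale^~ x : a b / a + b}.
Proof. by move=> a b; by_eval scalerDl. Qed.

HB.instance Definition _ := GRing.Zmodule_isLmodule.Build C B
  coprod_scaleA coprod_scale1 coprod_scaleDr coprod_scaleDl.

Fact coprod_scaleAl (a : C) (x y : B) : a *: (x * y) = a *: x * y.
Proof. by by_eval scalerAl. Qed.

HB.instance Definition _ := GRing.Lmodule_isLalgebra.Build C B coprod_scaleAl.

Fact coprod_scaleAr (a : C) (x y : B) : a *: (x * y) = x * (a *: y).
Proof. by by_eval scalerAr. Qed.

HB.instance Definition _ := GRing.Lalgebra_isAlgebra.Build C B coprod_scaleAr.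

Fact coprod_starK : involutive coprod_star.
Proof. by move=> x; by_eval (@starK C). Qed.
Fact coprod_starD : {morph coprod_star : x y / x + y}.
Proof. by move=> x y; by_eval (@starD C). Qed.
Fact coprod_starM x y : coprod_star (x * y) = coprod_star y * coprod_star x.
Proof. by by_eval (@starM C). Qed.
Fact coprod_starZ (a : C) x : coprod_star (a *: x) =
  Num.conj a *: coprod_star x.
Proof. by by_eval (@starZ C). Qed.

HB.instance Definition _ := isStarAlgebra.Build C B
  coprod_starK coprod_starD coprod_starM coprod_starZ.

Definition coprod_in k (x : A k) : B := coprod_pi (Gen x).

Lemma coprod_eval_in (D : starAlgType C) (f : forall k, A k -> D) k (x : A k) :
  star_family f -> coprod_eval f (coprod_in x) = f k x.
Proof. by move=> hf; rewrite coprod_eval_pi. Qed.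

Lemma coprod_in_hom : star_family coprod_in.
Proof.
move=> k; split=> [a x y | x y | x | u]; apply: coprod_ext => D f hf;
  by rewrite ?(coprod_evalE hf) !coprod_eval_in //; case: (hf k) => L M S U;
     rewrite ?L ?M ?S ?U.
Qed.

Lemma coprod_eval_hom (D : starAlgType C) (f : forall k, A k -> D) :
  star_family f -> is_star_hom true (coprod_eval f).
Proof.
by move=> hf; split=> [a x y | x y | x | _];
  rewrite ?(coprod_evalE hf).
Qed.

(** Existence is evaluation of terms. For uniqueness, every element is the class of a term, on which
    a unital *-homomorphism is forced by its values on generators, by induction on the term. *)
Lemma coprod_free_product : is_free_product unital coprod_in.
Proof.
split=> [|D f hf]; first exact: coprod_in_hom.
exists (coprod_eval f); split.
  by split=> [|k x]; [exact: coprod_eval_hom | exact: coprod_eval_in].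
move=> g [[gL gM gS gU] gE]; apply/funext => x.
have g0 : g 0 = 0 by have := gL (-1) 0 0; rewrite scaler0 addr0 scaleN1r addNr.
have gZ a y : g (a *: y) = a *: g y by rewrite -[a *: y]addr0 gL g0 addr0.
have gD y z : g (y + z) = g y + g z by have := gL 1 y z; rewrite !scale1r.
suff E t : g (coprod_pi t) =
  eval f t by rewrite -[x]coprod_reprK E coprod_eval_pi.
(* This reduces the identity between the class of a compound term and the corresponding operation on
   classes to a check under all evaluations. *)
have piE (s1 s2 : B) : (forall (D' : starAlgType C) (f' : forall k, A k ->
  D'), star_family f' ->
     coprod_eval f' s1 = coprod_eval f' s2) -> g s1 = g s2.
  by move=> /coprod_ext ->.
elim: t => [k y | | s Es t Et | s Es t Et | a t Et | t Et] /=.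
- exact: gE.
- by rewrite -gU.
- rewrite -Es -Et -gD; apply: piE => D' f' hf'.
  by rewrite !(coprod_evalE hf') !coprod_eval_pi.
- rewrite -Es -Et -gM; apply: piE => D' f' hf'.
  by rewrite !(coprod_evalE hf') !coprod_eval_pi.
- rewrite -Et -gZ; apply: piE => D' f' hf'.
  by rewrite !(coprod_evalE hf') !coprod_eval_pi.
- rewrite -Et -gS; apply: piE => D' f' hf'.
  by rewrite !(coprod_evalE hf') !coprod_eval_pi.
Qed.

End Structure.
End FreeProduct.

(** * Row- and column-finite matrices *)

(** Both sums reduce to the common part of the lists. Hence a matrix product may be computed over
    any finite list outside which its terms vanish. *)
Lemma eq_big_support (V : nmodType) (P : eqType) (F : P -> V) (s t : seq P) :
  uniq s -> uniq t -> (forall r, r \notin s -> F r = 0) ->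
  (forall r, r \notin t -> F r = 0) ->
  \sum_(r <- s) F r = \sum_(r <- t) F r.
Proof.
move=> us ut Fs Ft.
rewrite (bigID (mem t)) /= [X in _ + X]big1 ?addr0; last by move=> r /Ft.
rewrite [RHS](bigID (mem s)) /= [X in _ = _ + X]big1 ?addr0;
  last by move=> r /Fs.
rewrite -big_filter -[RHS]big_filter; apply: perm_big.
apply: uniq_perm; rewrite ?filter_uniq // => r.
by rewrite !mem_filter andbC.
Qed.

Section LocallyFiniteMatrix.
Variables (C : numClosedFieldType) (P : eqType).

(** Finite rows make products well defined; finite columns are required as well because the adjoint
    exchanges rows and columns. *)
Definition locally_finite (f : P -> P -> C) : Prop :=
  forall p, exists s : seq P, forall q, q \notin s -> f p q = 0 /\ f q p = 0.

Record lfmx := LFMx { lfmx_fun :> P -> P -> C; _ : locally_finite lfmx_fun }.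

HB.instance Definition _ := gen_eqMixin lfmx.
HB.instance Definition _ := gen_choiceMixin lfmx.

Implicit Types X Y Z : lfmx.

Lemma lfmxP X Y : (forall p q, X p q = Y p q) -> X = Y.
Proof.
case: X Y => f hf [g hg] /= E.
have Efg : f = g by apply/funext => p; apply/funext => q.
by case: _ / Efg hg => hg; congr LFMx; apply: Prop_irrelevance.
Qed.

Lemma lfmx_finite X p :
  exists s : seq P, forall q, q \notin s -> X p q = 0 /\ X q p = 0.
Proof. by case: X. Qed.

Definition lfmx_supp X p : seq P := undup (projT1 (cid (lfmx_finite X p))).

Lemma lfmx_supp_uniq X p : uniq (lfmx_supp X p).
Proof. exact: undup_uniq. Qed.

Lemma lfmx_row0 X p q : q \notin lfmx_supp X p -> X p q = 0.
Proof. by rewrite mem_undup; case: (cid _) => s hs /= /hs[]. Qed.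

Lemma lfmx_col0 X p q : q \notin lfmx_supp X p -> X q p = 0.
Proof. by rewrite mem_undup; case: (cid _) => s hs /= /hs[]. Qed.

Definition lfmx_mul_fun X Y p q := \sum_(r <- lfmx_supp X p) X p r * Y r q.

Lemma lfmx_mul_funE X Y p q (s : seq P) : uniq s ->
  (forall r, r \notin s -> X p r * Y r q = 0) ->
  lfmx_mul_fun X Y p q = \sum_(r <- s) X p r * Y r q.
Proof.
move=> us s0; apply: eq_big_support => // [|r /lfmx_row0 ->].
  exact: lfmx_supp_uniq.
by rewrite mul0r.
Qed.

Lemma lfmx_mul_fun_neq0 X Y p q :
  lfmx_mul_fun X Y p q != 0 -> exists r, X p r != 0 /\ Y r q != 0.
Proof.
move=> XY0; apply: contrapT => nex; case/eqP: XY0; apply: big1 => r _.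
apply/eqP; apply: contraT.
by rewrite mulf_eq0 negb_or => /andP[Xr Yr]; case: nex; exists r.
Qed.

Fact lfmx_add_finite X Y : locally_finite (fun p q => X p q + Y p q).
Proof.
move=> p; exists (lfmx_supp X p ++ lfmx_supp Y p) => q.
rewrite mem_cat negb_or => /andP[qX qY].
by rewrite !(lfmx_row0 qX, lfmx_row0 qY, lfmx_col0 qX, lfmx_col0 qY) addr0.
Qed.

Fact lfmx_scale_finite a X : locally_finite (fun p q => a * X p q).
Proof.
move=> p; exists (lfmx_supp X p) => q qX.
by rewrite (lfmx_row0 qX) (lfmx_col0 qX) mulr0.
Qed.

Fact lfmx_zero_finite : locally_finite (fun _ _ => 0).
Proof. by move=> p; exists [::]. Qed.

Fact lfmx_one_finite : locally_finite (fun p q => (p == q)%:R).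
Proof.
by move=> p; exists [:: p] => q; rewrite inE eq_sym => /negPf E;
  rewrite ?[q == p]eq_sym E.
Qed.

Fact lfmx_star_finite X : locally_finite (fun p q => Num.conj (X q p)).
Proof.
move=> p; exists (lfmx_supp X p) => q qX.
by rewrite (lfmx_row0 qX) (lfmx_col0 qX) rmorph0.
Qed.

Fact lfmx_mul_finite X Y : locally_finite (lfmx_mul_fun X Y).
Proof.
move=> p; exists (flatten [seq lfmx_supp Y r | r <- lfmx_supp X p] ++
                  flatten [seq lfmx_supp X r | r <- lfmx_supp Y p]) => q.
rewrite mem_cat negb_or => /andP[qY qX]; split; apply/eqP; apply: contraT.
  move=> /lfmx_mul_fun_neq0[r [Xr Yr]]; case/negP: qY; apply/flatten_mapP.
  exists r; first by apply: contraNT Xr => /lfmx_row0 ->.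
  by apply: contraNT Yr => /lfmx_row0 ->.
move=> /lfmx_mul_fun_neq0[r [Xr Yr]]; case/negP: qX; apply/flatten_mapP.
exists r; first by apply: contraNT Yr => /lfmx_col0 ->.
by apply: contraNT Xr => /lfmx_col0 ->.
Qed.

Definition lfmx_add X Y := LFMx (lfmx_add_finite X Y).
Definition lfmx_scale a X := LFMx (lfmx_scale_finite a X).
Definition lfmx_zero := LFMx lfmx_zero_finite.
Definition lfmx_one := LFMx lfmx_one_finite.
Definition lfmx_mul X Y := LFMx (lfmx_mul_finite X Y).
Definition lfmx_star X := LFMx (lfmx_star_finite X).
Definition lfmx_opp X := lfmx_scale (-1) X.

Fact lfmx_addA : associative lfmx_add.
Proof. by move=> X Y Z; apply: lfmxP => p q /=; rewrite addrA. Qed.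
Fact lfmx_addC : commutative lfmx_add.
Proof. by move=> X Y; apply: lfmxP => p q /=; rewrite addrC. Qed.
Fact lfmx_add0 : left_id lfmx_zero lfmx_add.
Proof. by move=> X; apply: lfmxP => p q /=; rewrite add0r. Qed.
Fact lfmx_addN : left_inverse lfmx_zero lfmx_opp lfmx_add.
Proof. by move=> X; apply: lfmxP => p q /=; rewrite mulN1r addNr. Qed.

HB.instance Definition _ :=
  GRing.isZmodule.Build lfmx lfmx_addA lfmx_addC lfmx_add0 lfmx_addN.

Fact lfmx_scaleA a b X : lfmx_scale a (lfmx_scale b X) = lfmx_scale (a * b) X.
Proof. by apply: lfmxP => p q /=; rewrite mulrA. Qed.
Fact lfmx_scale1 : left_id 1 lfmx_scale.
Proof. by move=> X; apply: lfmxP => p q /=; rewrite mul1r. Qed.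
Fact lfmx_scaleDr : right_distributive lfmx_scale +%R.
Proof. by move=> a X Y; apply: lfmxP => p q /=; rewrite mulrDr. Qed.
Fact lfmx_scaleDl X : {morph lfmx_scale^~ X : a b / a + b}.
Proof. by move=> a b; apply: lfmxP => p q /=; rewrite mulrDl. Qed.

HB.instance Definition _ := GRing.Zmodule_isLmodule.Build C lfmx
  lfmx_scaleA lfmx_scale1 lfmx_scaleDr lfmx_scaleDl.

Fact lfmx_mulA : associative lfmx_mul.
Proof.
move=> X Y Z; apply: lfmxP => p q /=.
(* Summing over the support of column q of [Z] makes the ranges of the two sums independent, so that
   they can be exchanged. *)
rewrite [RHS](@lfmx_mul_funE (lfmx_mul X Y) Z p q (lfmx_supp Z q))
  ?lfmx_supp_uniq //; last first.
  by move=> r /lfmx_col0 ->; rewrite mulr0.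
under [RHS]eq_bigr => u _ do rewrite big_distrl /=.
rewrite exchange_big /=; apply: eq_bigr => r _.
rewrite /= (@lfmx_mul_funE Y Z r q (lfmx_supp Z q)) ?lfmx_supp_uniq //;
  last first.
  by move=> u /lfmx_col0 ->; rewrite mulr0.
by rewrite big_distrr /=; apply: eq_bigr => u _; rewrite mulrA.
Qed.

Fact lfmx_mul1l : left_id lfmx_one lfmx_mul.
Proof.
move=> X; apply: lfmxP => p q /=.
rewrite (@lfmx_mul_funE _ _ _ _ [:: p]) ?big_seq1 /= ?eqxx ?mul1r // => r.
by rewrite inE eq_sym => /negPf ->; rewrite mul0r.
Qed.

Fact lfmx_mul1r : right_id lfmx_one lfmx_mul.
Proof.
move=> X; apply: lfmxP => p q /=.
rewrite (@lfmx_mul_funE _ _ _ _ [:: q]) ?big_seq1 /= ?eqxx ?mulr1 // => r.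
by rewrite inE => /negPf ->; rewrite mulr0.
Qed.

Fact lfmx_mulDr : right_distributive lfmx_mul +%R.
Proof.
move=> X Y Z; apply: lfmxP => p q /=.
by rewrite -big_split /=; apply: eq_bigr => r _; rewrite mulrDr.
Qed.

Fact lfmx_starK : involutive lfmx_star.
Proof. by move=> X; apply: lfmxP => p q /=; rewrite conjCK. Qed.

Fact lfmx_starM X Y : lfmx_star (lfmx_mul X Y) =
  lfmx_mul (lfmx_star Y) (lfmx_star X).
Proof.
apply: lfmxP => p q /=; rewrite [RHS](@lfmx_mul_funE _ _ _ _ (lfmx_supp X q))
  ?lfmx_supp_uniq //.
  by rewrite rmorph_sum /=; apply: eq_bigr => r _; rewrite rmorphM mulrC.
by move=> r /lfmx_row0 /= ->; rewrite rmorph0 mulr0.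
Qed.

Fact lfmx_starD : {morph lfmx_star : X Y / X + Y}.
Proof. by move=> X Y; apply: lfmxP => p q /=; rewrite rmorphD. Qed.

Fact lfmx_mulDl : left_distributive lfmx_mul +%R.
Proof.
move=> X Y Z; apply: (can_inj lfmx_starK).
by rewrite !(lfmx_starM, lfmx_starD) lfmx_mulDr.
Qed.

End LocallyFiniteMatrix.

Section LFMxAlgebra.
Variables (C : numClosedFieldType) (P : eqType) (p0 : P).

(* The index [p0] makes the index type nonempty, hence 1 <> 0; it is also the
   vacuum of the state. *)
Definition plfmx of P := lfmx C P.
Local Notation M := (plfmx p0).

HB.instance Definition _ := GRing.Lmodule.on M.

Implicit Types X Y : M.

Fact lfmx_one_neq0 : (lfmx_one C P : M) != 0.
Proof.
apply/eqP => /(congr1 (fun X : lfmx C P => X p0 p0)) /= /eqP.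
by rewrite eqxx oner_eq0.
Qed.

HB.instance Definition _ := GRing.Zmodule_isNzRing.Build M
  (@lfmx_mulA C P) (@lfmx_mul1l C P) (@lfmx_mul1r C P)
  (@lfmx_mulDl C P) (@lfmx_mulDr C P) lfmx_one_neq0.

Fact lfmx_scaleAl (a : C) X Y : a *: (X * Y) = a *: X * Y.
Proof.
apply: lfmxP => p q /=; rewrite [RHS](@lfmx_mul_funE _ _ _ _ _ _ (lfmx_supp X
  p)) ?lfmx_supp_uniq //.
  by rewrite big_distrr /=; apply: eq_bigr => r _; rewrite mulrA.
by move=> r /lfmx_row0 /= ->; rewrite mulr0 mul0r.
Qed.

HB.instance Definition _ := GRing.Lmodule_isLalgebra.Build C M lfmx_scaleAl.

Fact lfmx_scaleAr (a : C) X Y : a *: (X * Y) = X * (a *: Y).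
Proof.
apply: lfmxP => p q /=.
by rewrite big_distrr /=; apply: eq_bigr => r _; rewrite mulrCA.
Qed.

HB.instance Definition _ := GRing.Lalgebra_isAlgebra.Build C M lfmx_scaleAr.

Fact lfmx_starZ (a : C) X : lfmx_star (a *: X) =
  Num.conj a *: (lfmx_star X : M).
Proof. by apply: lfmxP => p q /=; rewrite rmorphM. Qed.

HB.instance Definition _ := isStarAlgebra.Build C M
  (@lfmx_starK C P) (@lfmx_starD C P) (@lfmx_starM C P) lfmx_starZ.

Definition vacuum (X : M) : C := X p0 p0.

Lemma vacuum_state : is_state vacuum.
Proof.
split=> [a X Y | | X] //; first by rewrite /vacuum /= eqxx.
(* The vacuum entry of [star X * X] is the sum of the squared moduli of the entries in the vacuum
   column of [X]. *)
apply: sumr_ge0 => r _; rewrite mulrC; exact: mul_conjC_ge0.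
Qed.

Definition lfmx_space : probSpace C := ProbSpace vacuum_state.

Lemma lfmxM_neq0 X Y p q :
  (X * Y : M) p q != 0 -> exists r, X p r != 0 /\ Y r q != 0.
Proof. exact: lfmx_mul_fun_neq0. Qed.

Lemma lfmxM_single X Y p q r :
  (forall u, u != r -> X p u * Y u q = 0) -> (X * Y : M) p q = X p r * Y r q.
Proof.
move=> r1; rewrite [LHS](@lfmx_mul_funE _ _ _ _ _ _ [:: r]) ?big_seq1 // => u.
by rewrite inE => /r1.
Qed.

End LFMxAlgebra.
Arguments plfmx : clear implicits.

(* [split] decomposes some of the points of [P] as pairs in [P' * Q]; [amp X]
   is X (x) 1 on their span, and 0 on the other points. *)
Section Amplification.
Variables (C : numClosedFieldType) (P' Q P : eqType) (p0' : P') (p0 : P).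
Variables (join : P' -> Q -> P) (split : P -> option (P' * Q)).
Hypothesis splitK : forall p x z, split p = Some (x, z) -> join x z = p.
Hypothesis joinK : forall p x z, split p = Some (x, z) ->
  forall y, split (join y z) = Some (y, z).

Definition amp_fun (X : plfmx C P' p0') (p q : P) : C :=
  if (split p, split q) is (Some (x, z), Some (y, z'))
  then (if z == z' then X x y else 0) else 0.

Lemma amp_funE X p q x y z :
  split p = Some (x, z) -> split q = Some (y, z) -> amp_fun X p q = X x y.
Proof. by rewrite /amp_fun => -> ->; rewrite eqxx. Qed.

Lemma amp_fun_neq0 X p q : amp_fun X p q != 0 ->
  exists x y z, [/\ split p = Some (x, z), split q = Some (y, z) & X x y != 0].
Proof.
rewrite /amp_fun; case: (split p) => [[x z]|]; last by rewrite /= eqxx.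
case: (split q) => [[y z']|] /=; last by rewrite eqxx.
case: (z =P z') => [->|]; last by rewrite eqxx.
by move=> Xxy; exists x, y, z'.
Qed.

Fact amp_finite X : locally_finite (amp_fun X).
Proof.
move=> p; case Ep: (split p) => [[x z]|].
  exists [seq join y z | y <- lfmx_supp X x] => q qX.
  split; apply/eqP; apply: contraT => /amp_fun_neq0[x' [y' [z' []]]].
    rewrite Ep => -[<- <-] /splitK Eq.
    apply: contraNT => _; apply/eqP/lfmx_row0; apply: contra qX => yX.
    by rewrite -Eq map_f.
  move=> /splitK Eq; rewrite Ep => -[<- Ez].
  apply: contraNT => _; apply/eqP/lfmx_col0; apply: contra qX => yX.
  by rewrite -Eq -Ez map_f.
exists [::] => q _; split; apply/eqP; apply: contraT.
  by move=> /amp_fun_neq0[x [y [z []]]]; rewrite Ep.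
by move=> /amp_fun_neq0[x [y [z []]]]; rewrite Ep.
Qed.

Definition amp X : plfmx C P p0 := LFMx (amp_finite X).

(** From a point with second component z, [amp X] leads only to points [join y z], so that the
    intermediate sum is the one over y in [P']. *)
Lemma amp_mul X Y : amp (X * Y) = amp X * amp Y.
Proof.
apply: lfmxP => p q; case Ep: (split p) => [[x z]|]; last first.
  transitivity (0 : C); first by rewrite /= /amp_fun Ep.
  apply/esym/eqP; apply: contraT => /lfmxM_neq0[r []].
  by rewrite /= {1}/amp_fun Ep eqxx.
rewrite [RHS](@lfmx_mul_funE _ _ _ _ _ _ [seq join y z | y <- lfmx_supp X x]);
  last first.
- move=> r rX; apply/eqP; apply: contraT;
  rewrite mulf_eq0 negb_or => /andP[+ _].
  move=> /amp_fun_neq0[x' [y' [z' [Ep' Er Xxy]]]]; case/negP: rX.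
  move: Ep' Xxy; rewrite Ep => -[-> ->] Xxy; rewrite -(splitK Er) map_f //.
  by apply: contraNT Xxy => yX; rewrite (lfmx_row0 yX).
- rewrite map_inj_in_uniq ?lfmx_supp_uniq // => y y' _ _ /(congr1 split).
  by rewrite !(joinK Ep) => -[].
rewrite big_map.
under eq_bigr => y _ do rewrite /= (amp_funE _ Ep (joinK Ep y)).
rewrite /= {1}/amp_fun Ep.
case Eq: (split q) => [[y z']|]; last first.
  by rewrite big1 // => y _; rewrite /amp_fun Eq (joinK Ep) mulr0.
have [Ez | nz] := eqVneq z z'.
  by apply: eq_bigr => r _; rewrite (amp_funE _ (joinK Ep r) (y := y)) // Eq Ez.
by rewrite big1 // => r _; rewrite /amp_fun Eq (joinK Ep) (negPf nz) mulr0.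
Qed.

(** [amp 1] is the projection onto the points that [split] decomposes, hence the unit exactly when
    all points decompose. *)
Lemma amp_hom (unital : bool) :
  (unital -> forall p, split p != None) -> is_star_hom unital amp.
Proof.
move=> total; split=> [a X Y | X Y | X | u].
- apply: lfmxP => p q /=; rewrite /amp_fun.
  case: (split p) => [[x z]|]; last by rewrite mulr0 addr0.
  case: (split q) => [[y z']|]; last by rewrite mulr0 addr0.
  by case: eqP => // _; rewrite mulr0 addr0.
- exact: amp_mul.
- apply: lfmxP => p q /=; rewrite /amp_fun.
  case: (split p) => [[x z]|]; last by case: (split q) => [[y z']|];
    rewrite rmorph0.
  case: (split q) => [[y z']|]; last by rewrite rmorph0.
  by rewrite eq_sym; case: eqP => // _; rewrite rmorph0.
- apply: lfmxP => p q /=; rewrite /amp_fun.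
  case Ep: (split p) (total u p) => [[x z]|] // _.
  case Eq: (split q) (total u q) => [[y z']|] // _.
  have [Ez | nz] := eqVneq z z'; last first.
    by case: (p =P q) => // Epq; move: nz; rewrite Epq Eq in Ep;
      case: Ep => _ ->; rewrite eqxx.
  congr ((nat_of_bool _)%:R); apply/eqP/eqP => [Exy | Epq].
    by rewrite -(splitK Ep) Exy Ez (splitK Eq).
  by move: Ep; rewrite Epq Eq => -[].
Qed.

Lemma amp_vacuum z0 X : split p0 = Some (p0', z0) -> vacuum (amp X) = vacuum X.
Proof. by move=> E; rewrite /vacuum /= (amp_funE _ E E). Qed.

End Amplification.

(** * Realizations of the independences *)

(** An embedding of alphabets with decidable image: the partial inverse [sa_out] lets words and
    occupation numbers be restricted to the image. *)
Record sub_alphabet (S' S : eqType) := SubAlphabet {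
  sa_in : S' -> S;
  sa_out : S -> option S';
  sa_inK : pcancel sa_in sa_out;
  sa_outK : forall s s', sa_out s = Some s' -> sa_in s' = s
}.

Definition sa_range S' S (h : sub_alphabet S' S) : pred S :=
  fun s => isSome (sa_out h s).

Definition sa_image S' S (h : sub_alphabet S' S) (b : pred S') : pred S :=
  fun s => oapp b false (sa_out h s).

Definition disjoint_labels (S L : eqType) (a : L -> pred S) : Prop :=
  forall l l' s, a l s -> a l' s -> l = l'.

(* A realization of an independence: matrices indexed by [rz_pt S], the points
   of a "Fock space" over the alphabet [S], together with the matrices that
   are local to a part of [S]. *)
Record realization (C : numClosedFieldType) (ty : independence) := Realization {
  rz_pt : eqType -> eqType;
  rz_vac : forall S : eqType, rz_pt S;
  rz_local : forall S : eqType, pred S -> plfmx C (rz_pt S) (rz_vac S) -> Prop;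
  rz_lift : forall S' S : eqType, sub_alphabet S' S ->
    plfmx C (rz_pt S') (rz_vac S') -> plfmx C (rz_pt S) (rz_vac S);
  rz_nth : nat -> rz_pt unit;
  rz_nth_inj : injective rz_nth;
  rz_nth0 : rz_nth 0 = rz_vac unit;
  rz_lift_hom : forall (S' S : eqType) (h : sub_alphabet S' S),
    is_star_hom (units_identified ty) (rz_lift h);
  rz_lift_vacuum : forall (S' S : eqType) (h : sub_alphabet S' S) X,
    vacuum (rz_lift h X) = vacuum X;
  rz_local_full : forall (S : eqType) (X : plfmx C (rz_pt S) (rz_vac S)),
    rz_local predT X;
  rz_local_lift : forall (S' S : eqType) (h : sub_alphabet S' S) (b : pred S')
    X,
    rz_local b X -> rz_local (sa_image h b) (rz_lift h X);
  rz_local_indep : forall (S L : eqType) (a : L -> pred S) (n : nat)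
      (lam : 'I_n -> L) (X : 'I_n -> plfmx C (rz_pt S) (rz_vac S)),
    (2 <= n)%N -> disjoint_labels a ->
    (forall i, rz_local (a (lam i)) (X i)) ->
    (forall i j : 'I_n, j = i.+1 :> nat -> lam i != lam j) ->
    independence_rule ty (@vacuum C (rz_pt S) (rz_vac S)) lam X
}.

(** * Longest prefixes of words over a part of the alphabet *)

Section Words.
Variables (S : eqType) (a : pred S).
Implicit Types w x z : seq S.

Fixpoint prefix_in w : seq S :=
  if w is s :: w' then if a s then s :: prefix_in w' else [::] else [::].
Fixpoint rest_in w : seq S :=
  if w is s :: w' then if a s then rest_in w' else w else [::].

Lemma prefix_rest w : prefix_in w ++ rest_in w = w.
Proof. by elim: w => //= s w IH; case: ifP => //= _; rewrite IH. Qed.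

Lemma prefix_in_cat x z : all a x -> prefix_in (x ++ z) = x ++ prefix_in z.
Proof. by elim: x => //= s x IH /andP[-> /IH ->]. Qed.

Lemma rest_in_cat x z : all a x -> rest_in (x ++ z) = rest_in z.
Proof. by elim: x => //= s x IH /andP[-> /IH ->]. Qed.

Lemma prefix_in_all w : all a (prefix_in w).
Proof. by elim: w => //= s w IH; case: ifP => //= ->. Qed.

Lemma prefix_in_rest w : prefix_in (rest_in w) = [::].
Proof. by elim: w => //= s w IH; case: ifP => //= ->. Qed.

Lemma rest_in_id w : prefix_in w = [::] -> rest_in w = w.
Proof. by case: w => //= s w; case: ifP. Qed.

End Words.

Lemma prefix_in_sub (S : eqType) (a b : pred S) w :
  subpred a b -> prefix_in b w = [::] -> prefix_in a w = [::].
Proof.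
case: w => //= s w ab; case: ifP => // /negbT bs _.
by rewrite ifN //; apply: contra bs; apply: ab.
Qed.

Section SubAlphabetWords.
Variables (S' S : eqType) (h : sub_alphabet S' S).

Lemma sa_image_in b s' : sa_image h b (sa_in h s') = b s'.
Proof. by rewrite /sa_image sa_inK. Qed.

Lemma sa_range_in s' : sa_range h (sa_in h s').
Proof. by rewrite /sa_range sa_inK. Qed.

Lemma sa_image_sub b : subpred (sa_image h b) (sa_range h).
Proof. by move=> s; rewrite /sa_image /sa_range; case: (sa_out h s). Qed.

Lemma map_pmap_sa w : all (sa_range h) w ->
  map (sa_in h) (pmap (sa_out h) w) = w.
Proof.
elim: w => //= s w IH; rewrite {1}/sa_range.
by case E: (sa_out h s) => [s'|] //= /IH ->; rewrite (sa_outK E).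
Qed.

Lemma pmap_map_sa x : pmap (sa_out h) (map (sa_in h) x) = x.
Proof. exact: (map_pK (@sa_inK _ _ h)). Qed.

Lemma all_sa_range_map x : all (sa_range h) (map (sa_in h) x).
Proof. by rewrite all_map; apply/allP => s _ /=; apply: sa_range_in. Qed.

Lemma all_sa_image_map b x : all (sa_image h b) (map (sa_in h) x) = all b x.
Proof. by rewrite all_map; apply: eq_all => s /=; apply: sa_image_in. Qed.

Lemma prefix_in_map b x z : prefix_in (sa_image h b) z = [::] ->
  prefix_in (sa_image h b) (map (sa_in h) x ++ z) =
    map (sa_in h) (prefix_in b x).
Proof.
move=> z0; elim: x => //= s x IH.
by rewrite sa_image_in; case: ifP => // _; rewrite IH.
Qed.

Lemma rest_in_map b x z : prefix_in (sa_image h b) z = [::] ->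
  rest_in (sa_image h b) (map (sa_in h) x ++ z) =
    map (sa_in h) (rest_in b x) ++ z.
Proof.
move=> z0; elim: x => [|s x IH] /=; first exact: rest_in_id.
by rewrite sa_image_in; case: ifP.
Qed.

End SubAlphabetWords.

(** * Free independence: operators on words *)

Section FreeRealization.
Variable C : numClosedFieldType.
Local Notation M S := (plfmx C (seq S) [::]).

(* A weak form of "X = X0 (x) 1" for the factorization of a word into its
   longest prefix in [a] and the rest. *)
Definition free_local (S : eqType) (a : pred S) (X : M S) : Prop :=
  (forall p q, X p q != 0 -> rest_in a p = rest_in a q) /\
  (forall q, prefix_in a q = [::] -> X q q = X [::] [::]).

Section Lift.
Variables (S' S : eqType) (h : sub_alphabet S' S).

Definition free_split (w : seq S) : option (seq S' * seq S) :=
  Some (pmap (sa_out h) (prefix_in (sa_range h) w), rest_in (sa_range h) w).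

Definition free_join (x : seq S') (z : seq S) : seq S := map (sa_in h) x ++ z.

Lemma free_splitK p x z : free_split p = Some (x, z) -> free_join x z = p.
Proof.
by case=> <- <-; rewrite /free_join map_pmap_sa ?prefix_rest ?prefix_in_all.
Qed.

Lemma free_joinK p x z : free_split p = Some (x, z) ->
  forall y, free_split (free_join y z) = Some (y, z).
Proof.
case=> _ <- y; rewrite /free_split /free_join.
rewrite prefix_in_cat ?rest_in_cat ?all_sa_range_map // prefix_in_rest cats0.
by rewrite pmap_map_sa rest_in_id ?prefix_in_rest.
Qed.

Definition free_lift : M S' -> M S := amp [::] free_splitK.

Lemma free_lift_hom : is_star_hom true free_lift.
Proof. by apply: amp_hom => //; apply: free_joinK. Qed.

Lemma free_lift_vacuum X : vacuum (free_lift X) = vacuum X.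
Proof. exact: (amp_vacuum _ (z0 := [::])). Qed.

(** The prefix of a word over the image of b lies inside its prefix over the whole range of h, so it
    can be computed on the first component of the splitting. *)
Lemma free_local_lift b X :
  free_local b X -> free_local (sa_image h b) (free_lift X).
Proof.
have rest0 w : prefix_in (sa_image h b) (rest_in (sa_range h) w) = [::].
  by apply: (prefix_in_sub (@sa_image_sub _ _ h b)); apply: prefix_in_rest.
move=> [X1 X2]; split=> [p q | q].
  move=> /amp_fun_neq0[x [y [z [Ep Eq /X1 Exy]]]].
  have z0 : prefix_in (sa_image h b) z = [::] by case: Ep => _ <-.
  by rewrite -(free_splitK Ep) -(free_splitK Eq) !rest_in_map // Exy.
have E : free_split q = Some (pmap (sa_out h) (prefix_in (sa_range h) q),
  rest_in (sa_range h) q) by [].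
rewrite /= (amp_funE _ E E) (amp_funE _ (x := [::]) (y := [::]) (z := [::])) //.
rewrite -{1}(free_splitK E) /free_join prefix_in_map // => Eb.
by apply: X2; case: (prefix_in b _) Eb.
Qed.

End Lift.

Lemma free_local_full (S : eqType) (X : M S) : free_local predT X.
Proof.
by split=> [p q _ | [|//]] //; elim: p q => [|s p IH] //= [|t q] //=; elim: q.
Qed.

(** Acting on the vacuum from the right, each centred factor leaves a word that begins with a letter
    of its own label. The next factor has another label, and its diagonal entry at such a word is
    its vacuum entry, which is 0. *)
Lemma free_local_prod (S L : eqType) (a : L -> pred S) (n : nat)
    (lam : 'I_n -> L) (X : 'I_n -> M S) :
  disjoint_labels a -> (forall i, free_local (a (lam i)) (X i)) ->
  (forall i j : 'I_n, j = i.+1 :> nat -> lam i != lam j) ->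
  (forall i, X i [::] [::] = 0) ->
  forall p, (\prod_(i < n) X i : M S) p [::] != 0 ->
    (p = [::] -> n = 0%N) /\
    forall l, (forall i : 'I_n, i = 0%N :> nat -> l != lam i) ->
      prefix_in (a l) p = [::].
Proof.
move=> disj; elim: n lam X => [|n IH] lam X Xloc alt X0 p.
  rewrite big_ord0 /=; case: (p =P [::]) => [-> | _]; last by rewrite eqxx.
  by split.
rewrite big_ord_recl => /lfmxM_neq0[r [Xpr Yr]].
have alt' (i j : 'I_n) : j = i.+1 :> nat ->
  lam (lift ord0 i) != lam (lift ord0 j).
  by move=> Eij; apply: alt; rewrite !lift0 Eij.
have [_ pre] := IH (lam \o lift ord0) _ (fun i => Xloc _) alt' (fun i =>
  X0 _) r Yr.
have [Xrest Xdiag] := Xloc ord0.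
have r0 : prefix_in (a (lam ord0)) r = [::].
  by apply: pre => i Ei; apply: alt; rewrite lift0 Ei.
case: p Xpr => [|s p] Xpr.
  have Er : r = [::] by have := Xrest _ _ Xpr; rewrite /= [RHS]rest_in_id.
  by rewrite Er X0 eqxx in Xpr.
split=> // l /(_ ord0 erefl) l0 /=.
(* If the first letter of p were foreign to the label, p would equal r and the entry of the first
   factor would be a diagonal one, equal to its vacuum entry 0. *)
have as0 : a (lam ord0) s.
  apply: contraT => nas; have := Xrest _ _ Xpr;
    rewrite [RHS]rest_in_id //= ifN // => Er.
  by rewrite -Er Xdiag /= ?ifN // X0 eqxx in Xpr.
by rewrite ifN //; apply: contra l0 => als; apply/eqP/(disj _ _ _ als as0).
Qed.

Lemma free_local_indep (S L : eqType) (a : L -> pred S) (n : nat)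
    (lam : 'I_n -> L) (X : 'I_n -> M S) :
  (2 <= n)%N -> disjoint_labels a ->
  (forall i, free_local (a (lam i)) (X i)) ->
  (forall i j : 'I_n, j = i.+1 :> nat -> lam i != lam j) ->
  independence_rule Free (@vacuum C (seq S) [::]) lam X.
Proof.
move=> n2 disj Xloc alt X0; apply/eqP; apply: contraT => Y0.
have [/(_ erefl) n0 _] := free_local_prod disj Xloc alt X0 Y0.
by rewrite n0 in n2.
Qed.

(** Words over one letter supply the infinitely many distinct points between which the matrix units
    act. *)
Lemma nseq_unit_inj : injective (fun k => nseq k tt).
Proof. by move=> k k' /(congr1 size); rewrite !size_nseq. Qed.

Definition free_realization : realization C Free :=
  @Realization C Free (fun S => seq S) (fun S => [::]) free_local free_lift
    (fun k => nseq k tt) nseq_unit_inj erefl free_lift_hom free_lift_vacuum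
    free_local_full free_local_lift free_local_indep.

End FreeRealization.

(** * Boolean independence: operators supported on words over a part *)

Section BooleanRealization.
Variable C : numClosedFieldType.
Local Notation M S := (plfmx C (seq S) [::]).

(** For disjoint parts the supports share only the empty word, the vacuum common to the summands of
    a Boolean product. *)
Definition bool_local (S : eqType) (a : pred S) (X : M S) : Prop :=
  forall p q, X p q != 0 -> all a p /\ all a q.

Section Lift.
Variables (S' S : eqType) (h : sub_alphabet S' S).

Definition bool_split (w : seq S) : option (seq S' * unit) :=
  if all (sa_range h) w then Some (pmap (sa_out h) w, tt) else None.

Definition bool_join (x : seq S') (z : unit) : seq S := map (sa_in h) x.

Lemma bool_splitK p x z : bool_split p = Some (x, z) -> bool_join x z = p.
Proof.
by rewrite /bool_split /bool_join; case: ifP => // + [<- _]; apply: map_pmap_sa.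
Qed.

Lemma bool_join_split y z : bool_split (bool_join y z) = Some (y, z).
Proof. by case: z; rewrite /bool_split all_sa_range_map pmap_map_sa. Qed.

Lemma bool_joinK p x z : bool_split p = Some (x, z) ->
  forall y, bool_split (bool_join y z) = Some (y, z).
Proof. by move=> _ y; apply: bool_join_split. Qed.

Definition bool_lift : M S' -> M S := amp [::] bool_splitK.

Lemma bool_lift_hom : is_star_hom false bool_lift.
Proof. by apply: amp_hom => //; apply: bool_joinK. Qed.

Lemma bool_lift_vacuum X : vacuum (bool_lift X) = vacuum X.
Proof. exact: (amp_vacuum _ (z0 := tt)). Qed.

Lemma bool_local_lift b X :
  bool_local b X -> bool_local (sa_image h b) (bool_lift X).
Proof.
move=> X1 p q /amp_fun_neq0[x [y [z [/bool_splitK <- /bool_splitK <-]]]].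
by rewrite /bool_join !all_sa_image_map; apply: X1.
Qed.

End Lift.

Lemma bool_local_full (S : eqType) (X : M S) : bool_local predT X.
Proof. by move=> p q _; rewrite !all_predT. Qed.

(** Between two neighbouring factors a nonzero path passes through a word over two disjoint parts,
    hence through the empty word. The first conclusion is the invariant that carries the
    induction. *)
Lemma bool_local_prod (S L : eqType) (a : L -> pred S) (n : nat)
    (lam : 'I_n -> L) (X : 'I_n -> M S) :
  disjoint_labels a -> (forall i, bool_local (a (lam i)) (X i)) ->
  (forall i j : 'I_n, j = i.+1 :> nat -> lam i != lam j) ->
  (forall p, (\prod_(i < n) X i : M S) p [::] != 0 ->
    forall l, (forall i : 'I_n, i = 0%N :> nat -> l != lam i) ->
      all (a l) p -> p = [::]) /\
  (\prod_(i < n) X i : M S) [::] [::] = \prod_(i < n) X i [::] [::].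
Proof.
move=> disj; elim: n lam X => [|n IH] lam X Xloc alt.
  rewrite !big_ord0 /=; split=> // p; case: (p =P [::]) => // _.
  by rewrite eqxx.
have alt' (i j : 'I_n) : j = i.+1 :> nat ->
  lam (lift ord0 i) != lam (lift ord0 j).
  by move=> Eij; apply: alt; rewrite !lift0 Eij.
have [Y1 Y2] := IH (lam \o lift ord0) _ (fun i => Xloc _) alt'.
split=> [p|].
  rewrite big_ord_recl => /lfmxM_neq0[r [/(Xloc ord0)[p0 _] _]] l /(_ ord0
    erefl) l0.
  case: p p0 => //= s p /andP[as0 _] /andP[als _].
  by rewrite (disj _ _ _ als as0) eqxx in l0.
rewrite big_ord_recl [RHS]big_ord_recl -Y2; apply: lfmxM_single => u u0.
apply/eqP; apply: contraT; rewrite mulf_eq0 negb_or => /andP[Xu Yu].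
have [_ au] := Xloc ord0 _ _ Xu.
case/eqP: u0; apply: (Y1 u Yu (lam ord0)) => // i Ei.
by apply: alt; rewrite lift0 Ei.
Qed.

Lemma bool_local_indep (S L : eqType) (a : L -> pred S) (n : nat)
    (lam : 'I_n -> L) (X : 'I_n -> M S) :
  (2 <= n)%N -> disjoint_labels a ->
  (forall i, bool_local (a (lam i)) (X i)) ->
  (forall i j : 'I_n, j = i.+1 :> nat -> lam i != lam j) ->
  independence_rule Boolean (@vacuum C (seq S) [::]) lam X.
Proof. by move=> _ disj Xloc /(bool_local_prod disj Xloc)[]. Qed.

Definition bool_realization : realization C Boolean :=
  @Realization C Boolean (fun S => seq S) (fun S => [::]) bool_local bool_lift
    (fun k => nseq k tt) nseq_unit_inj erefl bool_lift_hom bool_lift_vacuum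
    bool_local_full bool_local_lift bool_local_indep.

End BooleanRealization.

Section ProdByLabel.
Variables (R : pzRingType) (J L : eqType) (lam : J -> L) (X : J -> R).
Hypothesis comX : forall i j, lam i != lam j -> GRing.comm (X i) (X j).

Lemma mulr_prod_label (x : R) (G : L -> R) (l0 : L) (s : seq L) :
  uniq s -> l0 \in s -> (forall l, l != l0 -> GRing.comm x (G l)) ->
  x * \prod_(l <- s) G l = \prod_(l <- s) (if l0 == l then x * G l else G l).
Proof.
move=> + + comG; elim: s => //= l s IH /andP[ls us]; rewrite inE !big_cons.
have [El _ | n0 /= l0s] := eqVneq l0 l; last first.
  by rewrite -IH // !mulrA comG // eq_sym.
rewrite mulrA; congr (_ * _); apply: eq_big_seq => l' l's.
by case: (l0 =P l') => // El0; rewrite -El El0 l's in ls.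
Qed.

(** Factors of different labels commute, so they can be collected label by label without changing
    the order within a label. *)
Lemma prod_by_label (r : seq J) (s : seq L) :
  uniq s -> {subset map lam r <= s} ->
  \prod_(i <- r) X i = \prod_(l <- s) \prod_(i <- r | lam i == l) X i.
Proof.
move=> us; elim: r => [|x r IH] rs.
  by rewrite big_nil big1 // => l _; rewrite big_nil.
rewrite big_cons IH; last by move=> l lr; apply: rs; rewrite inE lr orbT.
rewrite (mulr_prod_label (l0 := lam x)) //.
- by apply: eq_bigr => l _; rewrite big_cons.
- by apply: rs; rewrite inE eqxx.
move=> l nl; apply: commr_prod => i /eqP Ei; apply: comX.
by rewrite Ei eq_sym.
Qed.

End ProdByLabel.

(** * Tensor independence: operators on occupation numbers *)

Section TensorRealization.
Variable C : numClosedFieldType.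
Local Notation F S := (S -> nat).
Local Notation M S := (plfmx C (F S) (fun _ => 0%N)).

Definition off_diag (S : Type) (a : pred S) (X : M S) : Prop :=
  forall p q, X p q != 0 -> forall s, ~~ a s -> p s = q s.

(** The two clauses express X = X0 (x) 1: occupation numbers outside a are left unchanged, and the
    entry depends only on those in a. *)
Definition tensor_local (S : eqType) (a : pred S) (X : M S) : Prop :=
  off_diag a X /\
  (forall p q p' q' : F S, (forall s, a s -> p s = p' s) ->
     (forall s, a s -> q s = q' s) -> (forall s, ~~ a s -> p s = q s) ->
     (forall s, ~~ a s -> p' s = q' s) -> X p q = X p' q').

Lemma off_diag1 (S : Type) (a : pred S) : off_diag a (1 : M S).
Proof. by move=> p q /=; case: (p =P q) => [-> | _] //; rewrite eqxx. Qed.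

Lemma off_diagM (S : Type) (a : pred S) (X Y : M S) :
  off_diag a X -> off_diag a Y -> off_diag a (X * Y).
Proof.
move=> hX hY p q /lfmxM_neq0[r [/hX Xpr /hY Yrq]] s as0.
by rewrite Xpr ?Yrq.
Qed.

Lemma off_diag_sub (S : Type) (a b : pred S) (X : M S) :
  subpred a b -> off_diag a X -> off_diag b X.
Proof. by move=> ab hX p q /hX Xpq s bs; apply: Xpq; apply: contra bs;
  apply: ab. Qed.

(** An intermediate point agrees with the vacuum outside a and outside b, hence everywhere. *)
Lemma vacuum_mul_off_diag (S : Type) (a b : pred S) (X Y : M S) :
  (forall s, ~~ (a s && b s)) -> off_diag a X -> off_diag b Y ->
  vacuum (X * Y) = vacuum X * vacuum Y.
Proof.
move=> disj hX hY; apply: lfmxM_single => u u0; apply/eqP; apply: contraT.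
rewrite mulf_eq0 negb_or => /andP[/hX Xu /hY Yu].
case/eqP: u0; apply/funext => s.
case as0: (a s); last by rewrite -Xu // as0.
by apply: Yu; apply: contra (disj s) => bs; rewrite as0.
Qed.

(** Disjoint parts leave one possible intermediate point in either product. The nonzero entry forces
    p and q to agree outside both parts. *)
Lemma tensor_local_comm_entry (S : eqType) (a b : pred S) (X Y : M S) p q :
  (forall s, ~~ (a s && b s)) -> tensor_local a X -> tensor_local b Y ->
  (X * Y) p q != 0 -> (X * Y) p q = (Y * X) p q.
Proof.
move=> disj [X1 X2] [Y1 Y2] XY0.
have [r0 [/X1 Xr0 /Y1 Yr0]] := lfmxM_neq0 XY0.
have Epq s : ~~ a s -> ~~ b s -> p s = q s by move=> nas nbs; rewrite Xr0 ?Yr0.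
(* Halfway from p to q: [r] has only the coordinates in a changed, as after [X]; [t] has only those
   in b changed, as after [Y]. *)
pose r : F S := fun s => if a s then q s else p s.
pose t : F S := fun s => if b s then q s else p s.
have ab s : a s -> b s = false by move=> as0; have := disj s;
  rewrite as0 => /negPf.
have ba s : b s -> a s = false.
  by move=> bs0; have := disj s; rewrite bs0 andbT => /negPf.
rewrite (lfmxM_single (r := r)); last first.
  move=> u ur; apply/eqP; apply: contraT;
    rewrite mulf_eq0 negb_or => /andP[/X1 Xu /Y1 Yu].
  case/eqP: ur; apply/funext => s; rewrite /r; case as0: (a s);
    last by rewrite Xu // as0.
  by rewrite Yu // ab.
rewrite (lfmxM_single (r := t)); last first.
  move=> u ut; apply/eqP; apply: contraT;
    rewrite mulf_eq0 negb_or => /andP[/Y1 Yu /X1 Xu].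
  case/eqP: ut; apply/funext => s; rewrite /t; case bs0: (b s);
    last by rewrite Yu // bs0.
  by rewrite Xu // ba.
rewrite mulrC; congr (_ * _).
  apply: Y2 => s; rewrite /r /t.
  - by move=> /ba ->.
  - by move=> ->.
  - by move=> bs; case: ifP => // /negbT as0; apply: Epq.
  - by move=> /negPf ->.
apply: X2 => s; rewrite /r /t.
- by move=> /ab ->.
- by move=> ->.
- by move=> /negPf ->.
- by move=> as0; case: ifP => // /negbT bs0; apply: Epq.
Qed.

Lemma tensor_local_comm (S : eqType) (a b : pred S) (X Y : M S) :
  (forall s, ~~ (a s && b s)) -> tensor_local a X -> tensor_local b Y ->
  GRing.comm X Y.
Proof.
move=> disj hX hY; apply: lfmxP => p q.
have disj' s : ~~ (b s && a s) by rewrite andbC.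
have [XY0 |] := eqVneq ((X * Y) p q) 0; last exact: tensor_local_comm_entry.
have [YX0 | YX0] := eqVneq ((Y * X) p q) 0; first by rewrite [LHS]XY0 [RHS]YX0.
by rewrite [RHS](tensor_local_comm_entry disj' hY hX YX0).
Qed.

Lemma vacuum_prod_labels (S L : eqType) (a : L -> pred S) (G : L ->
  M S) (s : seq L) :
  disjoint_labels a -> uniq s -> (forall l, off_diag (a l) (G l)) ->
  vacuum (\prod_(l <- s) G l) = \prod_(l <- s) vacuum (G l).
Proof.
move=> disj us hG; elim: s us => [|l s IH] /=.
  by rewrite !big_nil /vacuum /= eqxx.
move=> /andP[ls us]; rewrite !big_cons -IH //.
(* The remaining product changes only coordinates in the union of the parts of its labels, which is
   disjoint from [a l]. *)
apply: (vacuum_mul_off_diag (a := a l) (b := fun x => has (a^~ x) s)) => [x||].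
- rewrite negb_and -implybE; apply/implyP => alx; apply/hasPn => l' l's.
  by apply: contraL l's => al'x; rewrite -(disj _ _ _ alx al'x).
- exact: hG.
suff hs (t : seq L) : {subset t <= s} ->
    off_diag (fun x => has (a^~ x) s) (\prod_(l <- t) G l) by exact: hs.
elim: t => [|l' t IHt] ts; first by rewrite big_nil; apply: off_diag1.
rewrite big_cons; apply: off_diagM; last first.
  by apply: IHt => l'' l''t; apply: ts; rewrite inE l''t orbT.
apply: off_diag_sub (hG l') => x al'; apply/hasP; exists l' => //.
by apply: ts; rewrite inE eqxx.
Qed.

Lemma tensor_local_indep (S L : eqType) (a : L -> pred S) (n : nat)
    (lam : 'I_n -> L) (X : 'I_n -> M S) :
  (2 <= n)%N -> disjoint_labels a ->
  (forall i, tensor_local (a (lam i)) (X i)) ->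
  (forall i j : 'I_n, j = i.+1 :> nat -> lam i != lam j) ->
  independence_rule Tensor (@vacuum C (F S) (fun _ => 0%N)) lam X.
Proof.
move=> _ disj Xloc _ /=.
have comX i j : lam i != lam j -> GRing.comm (X i) (X j).
  move=> nij; apply: tensor_local_comm (Xloc i) (Xloc j) => s.
  by apply: contra nij => /andP[ai aj]; apply/eqP/(disj _ _ _ ai aj).
rewrite (prod_by_label comX (undup_uniq (codom lam))) => [|l /mapP[i _ ->]].
  apply: (vacuum_prod_labels disj (undup_uniq _)) => l.
  elim/big_rec: _ => [|i x /eqP <- hx]; first exact: off_diag1.
  by apply: off_diagM => //; case: (Xloc i).
by rewrite mem_undup codom_f.
Qed.

Section Lift.
Variables (S' S : eqType) (h : sub_alphabet S' S).

(** The second component is set to 0 on the range of h, so that it retains nothing of the first. *)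
Definition tensor_split (w : F S) : option (F S' * F S) :=
  Some (fun s' => w (sa_in h s'), fun s => if sa_range h s then 0%N else w s).

Definition tensor_join (x : F S') (z : F S) : F S :=
  fun s => if sa_out h s is Some s' then x s' else z s.

Lemma tensor_splitK p x z : tensor_split p = Some (x, z) -> tensor_join x z = p.
Proof.
case=> <- <-; apply/funext => s; rewrite /tensor_join /sa_range.
by case E: (sa_out h s) => [s'|] //=; rewrite (sa_outK E).
Qed.

Lemma tensor_joinK p x z : tensor_split p = Some (x, z) ->
  forall y, tensor_split (tensor_join y z) = Some (y, z).
Proof.
case=> _ <- y; rewrite /tensor_split /tensor_join; congr (Some (_, _));
  apply/funext => s.
  by rewrite sa_inK.
by rewrite /sa_range; case: (sa_out h s).
Qed.

Definition tensor_lift : M S' -> M S := amp (fun _ => 0%N) tensor_splitK.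

Lemma tensor_lift_hom : is_star_hom true tensor_lift.
Proof. by apply: amp_hom => //; apply: tensor_joinK. Qed.

Lemma tensor_lift_vacuum X : vacuum (tensor_lift X) = vacuum X.
Proof.
apply: (amp_vacuum _ (z0 := fun _ => 0%N)).
by congr (Some (_, _)); apply/funext => s; case: ifP.
Qed.

Lemma tensor_local_lift b X :
  tensor_local b X -> tensor_local (sa_image h b) (tensor_lift X).
Proof.
move=> [X1 X2]; split=> [p q | p q p' q' pp' qq' pq p'q'].
  move=> /amp_fun_neq0[x [y [z [/tensor_splitK <- /tensor_splitK <- /X1
    Xxy]]]] s.
  rewrite /tensor_join /sa_image; case: (sa_out h s) => //= s'; exact: Xxy.
have out w w' : (forall s, ~~ sa_image h b s -> w s = w' s) ->
    (fun s => if sa_range h s then 0%N else w s) = (fun s =>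
      if sa_range h s then 0%N else w' s).
  move=> ww'; apply/funext => s; case: ifP => // /negbT ns; apply: ww'.
  by apply: contra ns; apply: sa_image_sub.
rewrite /= (amp_funE _ (y := fun s' =>
  q (sa_in h s')) (erefl (tensor_split p))); last first.
  by rewrite /tensor_split (out _ _ pq).
rewrite (amp_funE _ (y := fun s' =>
  q' (sa_in h s')) (erefl (tensor_split p'))); last first.
  by rewrite /tensor_split (out _ _ p'q').
by apply: X2 => s bs; [apply: pp' | apply: qq' | apply: pq | apply: p'q'];
  rewrite sa_image_in.
Qed.

End Lift.

Lemma tensor_local_full (S : eqType) (X : M S) : tensor_local predT X.
Proof.
split=> [p q _ s // | p q p' q' pp' qq' _ _].
by congr (X _ _); apply/funext => s; [apply: pp' | apply: qq'].
Qed.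

Lemma const_inj (k k' : nat) : (fun _ : unit => k) = (fun _ => k') -> k = k'.
Proof. by move=> /(congr1 (@^~ tt)). Qed.

Definition tensor_realization : realization C Tensor :=
  @Realization C Tensor (fun S => F S) (fun S _ => 0%N) tensor_local tensor_lift
    (fun k _ => k) const_inj erefl tensor_lift_hom tensor_lift_vacuum
    tensor_local_full tensor_local_lift tensor_local_indep.

End TensorRealization.

Definition realization_of (C : numClosedFieldType) (ty : independence) :
  realization C ty :=
  match ty with
  | Tensor => tensor_realization C
  | Free => free_realization C
  | Boolean => bool_realization C
  end.

(** * From concrete families to the universal product *)

Section StarHom.
Variables (C : numClosedFieldType) (A B : starAlgType C) (f : A -> B).

Lemma star_hom_range (unital : bool) :
  is_star_hom unital f -> is_star_subalgebra (range f).
Proof.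
case=> fL fM fS _; split.
- exists 0 => //; have := fL (-1) 0 0.
  by rewrite scaler0 addr0 scaleN1r addNr.
- by move=> a _ _ [x _ <-] [y _ <-]; exists (a *: x + y); rewrite ?fL.
- by move=> _ _ [x _ <-] [y _ <-]; exists (x * y); rewrite ?fM.
- by move=> _ [x _ <-]; exists (star x); rewrite ?fS.
Qed.

Lemma star_hom_prod1 (I : Type) (r : seq I) (P : pred I) (X : I -> A) :
  is_star_hom true f ->
  f (\prod_(i <- r | P i) X i) = \prod_(i <- r | P i) f (X i).
Proof. by case=> _ fM _ /(_ isT) f1; apply: big_morph. Qed.

(** A nonempty product avoids the unit, so that this also covers the Boolean embeddings. *)
Lemma star_hom_prod (unital : bool) (n : nat) (X : 'I_n -> A) :
  is_star_hom unital f -> (0 < n)%N ->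
  f (\prod_(i < n) X i) = \prod_(i < n) f (X i).
Proof.
case=> _ fM _ _; elim: n X => // -[|n] IH X _; first by rewrite !big_ord1.
by rewrite big_ord_recl fM IH // [RHS]big_ord_recl.
Qed.

Lemma independence_rule_hom (ty : independence) (psi : B -> C) (L : eqType)
    (n : nat) (lam : 'I_n -> L) (X : 'I_n -> A) :
  is_star_hom true f ->
  independence_rule ty psi lam (fun i => f (X i)) ->
  independence_rule ty (fun x => psi (f x)) lam X.
Proof.
move=> fH; case: ty => /=; rewrite star_hom_prod1 //.
by move=> ->; apply: eq_bigr => l _; rewrite star_hom_prod1.
Qed.

End StarHom.

Section UniversalFormula.
Variables (C : numClosedFieldType) (ty : independence).
Variables (I : finType) (A : I -> probSpace C).
Variables (D : starAlgType C) (f : forall k, A k -> D) (psi : D -> C).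
Hypothesis f_hom : star_family (units_identified ty) f.
Hypothesis psi_lin : scalar psi.
Hypothesis psi_f : forall k (x : A k), psi (f x) = ps_state x.
Hypothesis f_indep : independent ty psi (fun k => range (@f k)).

(** Evaluation sends the embedded algebras of the coproduct into the ranges of the [f k], so the
    pullback of [psi] inherits independence from the concrete family. *)
Lemma coprod_universal_product :
  let rep := ex_intro _ D (ex_intro _ f f_hom) in
  is_universal_product ty (@coprod_in C (units_identified ty) I A rep)
    (fun x => psi (coprod_eval f x)).
Proof.
move=> rep; have evalH := coprod_eval_hom rep f_hom.
have in_hom := @coprod_in_hom _ _ _ _ rep.
split; first exact: coprod_free_product.
- by move=> a x y; case: evalH => -> _ _ _; rewrite psi_lin.
- by move=> k x; rewrite coprod_eval_in.
have [_ f_unit f_rule] := f_indep; split=> [k | tyF k | n lam X n2 Xr alt].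
- exact: star_hom_range (in_hom k).
- have u : units_identified ty by rewrite tyF.
  by case: (in_hom k) => _ _ _ /(_ u) <-; exists 1.
have XrE i : range (@f (lam i)) (coprod_eval f (X i)).
  by case: (Xr i) => x _ <-; rewrite coprod_eval_in //; exists x.
have := f_rule n lam (fun i => coprod_eval f (X i)) n2 XrE alt.
exact: independence_rule_hom.
Qed.

(** The coefficients are defined through the free product; this transfers the expansion to any
    independent family inside an algebra [D]. *)
Lemma universal_formula (c : forall n, {set {set 'I_n}} -> {set {set 'I_n}} ->
  C)
    (n : nat) (pi : {set {set 'I_n}}) (X : 'I_n -> {k : I & A k}) :
  universal_coefficients ty c -> (1 <= n)%N -> is_partition pi ->
    in_blocks pi X ->
  psi (\prod_(i < n) f (tagged (X i))) =
  \sum_(sigma | is_partition sigma && refines sigma pi)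
    c n pi sigma * moment_part sigma X.
Proof.
move=> hc n1 hpi hX; rewrite -(hc n pi n1 hpi _ _ _ _ _
  coprod_universal_product X hX).
rewrite star_hom_prod1; last exact: coprod_eval_hom.
by congr psi; apply: eq_bigr => i _; rewrite coprod_eval_in.
Qed.

End UniversalFormula.

Section Letters.
Variables (K J : eqType).

Fact point_inK (v : K) :
  pcancel (fun _ : unit => v) (fun s => if s == v then Some tt else None).
Proof. by case; rewrite eqxx. Qed.

Fact point_outK (v : K) s (s' : unit) :
  (if s == v then Some tt else None) = Some s' -> v = s.
Proof. by case: eqP. Qed.

Definition point_alphabet v := SubAlphabet (point_inK v) (point_outK (v := v)).

Fact slice_inK (j : J) :
  pcancel (fun v : K => (v, j)) (fun s => if s.2 == j then Some s.1 else None).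
Proof. by move=> v /=; rewrite eqxx. Qed.

Fact slice_outK (j : J) (s : K * J) v :
  (if s.2 == j then Some s.1 else None) = Some v -> (v, j) = s.
Proof. by case: s => v' j' /=; case: eqP => // -> [->]. Qed.

Definition slice_alphabet j := SubAlphabet (slice_inK j) (slice_outK (j := j)).

End Letters.

(** * Spaces over letters, their copies, and the joint independent family *)

Section Model.
Variables (C : numClosedFieldType) (ty : independence).
Variables (rz : realization C ty) (K : eqType).

Definition rz_space (S : eqType) : probSpace C := lfmx_space C (rz_vac rz S).

Definition letter_map (v : K) : rz_space unit -> rz_space K :=
  rz_lift (point_alphabet v).

Definition copy_map (j : nat) : rz_space K -> rz_space (K * nat)%type :=
  rz_lift (slice_alphabet K j).

Lemma unital_hom (unital : bool) (A B : starAlgType C) (f : A -> B) :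
  is_star_hom unital f -> is_star_hom false f.
Proof. by case. Qed.

Lemma copy_map_hom j : is_star_hom (units_identified ty) (copy_map j).
Proof. exact: rz_lift_hom. Qed.

Lemma copy_map_state j x : ps_state (copy_map j x) = ps_state x.
Proof. exact: rz_lift_vacuum. Qed.

Lemma copy_map_moments j (n : nat) (X : 'I_n -> rz_space K) :
  ps_state (\prod_(i < n) copy_map j (X i)) = ps_state (\prod_(i < n) X i).
Proof.
have [n0 | n_gt0] := posnP n; last first.
  by rewrite -(star_hom_prod _ (copy_map_hom j)) // copy_map_state.
have := (ps_stateP (rz_space K), ps_stateP (rz_space (K * nat)%type)).
by subst n; rewrite !big_ord0 => -[[_ -> _] [_ -> _]].
Qed.

Lemma copy_map_indep :
  independent ty (@ps_state _ (rz_space (K * nat)%type)) (fun j =>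
    range (copy_map j)).
Proof.
split=> [j | tyF j | n lam X n2 Xr alt].
- exact: star_hom_range (copy_map_hom j).
- have u : units_identified ty by rewrite tyF.
  by case: (copy_map_hom j) => _ _ _ /(_ u) <-; exists 1.
apply: (rz_local_indep (a := fun j =>
  sa_image (slice_alphabet K j) predT)) n2 _ _ alt.
- move=> j j' s; rewrite /sa_image /=.
  by case: eqP => // <-; case: eqP.
- by move=> i; case: (Xr i) => x _ <-; apply/rz_local_lift/rz_local_full.
Qed.

Definition rz_copies : copies ty (rz_space K) :=
  Copies (fun j => unital_hom (copy_map_hom j)) copy_map_moments copy_map_indep.

Section Joint.
Variables (L : eqType) (lab : L -> K * nat).
Hypothesis lab_inj : injective lab.

Definition joint_map (l : L) (x : rz_space unit) : rz_space (K * nat)%type :=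
  copy_map (lab l).2 (letter_map (lab l).1 x).

Lemma joint_map_hom l : is_star_hom (units_identified ty) (joint_map l).
Proof.
have [L1 M1 S1 U1] := copy_map_hom (lab l).2.
have [L2 M2 S2 U2] : is_star_hom (units_identified ty) (letter_map (lab l).1).
  exact: rz_lift_hom.
by rewrite /joint_map; split=> [a x y | x y | x | u];
  rewrite ?(L2, M2, S2, U2) ?(L1, M1, S1, U1).
Qed.

Lemma joint_map_state l x : ps_state (joint_map l x) = ps_state x.
Proof. by rewrite copy_map_state; apply: rz_lift_vacuum. Qed.

(** Associativity enters here: the label (v, j) occupies the single letter (v, j) of [K * nat], so
    distinct labels are local to disjoint parts even though the embedding is done in two stages. *)
Lemma joint_map_indep :
  independent ty (@ps_state _ (rz_space (K * nat)%type)) (fun l =>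
    range (joint_map l)).
Proof.
split=> [l | tyF l | n lam X n2 Xr alt].
- exact: star_hom_range (joint_map_hom l).
- have u : units_identified ty by rewrite tyF.
  by case: (joint_map_hom l) => _ _ _ /(_ u) <-; exists 1.
apply: (rz_local_indep (a := fun l => sa_image (slice_alphabet K (lab l).2)
   (sa_image (point_alphabet (lab l).1) predT))) n2 _ _ alt.
- move=> l l' s; rewrite /sa_image /=; case: eqP => //= s2;
  case: eqP => //= s1 _.
  case: eqP => //= s2'; case: eqP => //= s1' _.
  apply: lab_inj; apply: injective_projections; congruence.
- by move=> i; case: (Xr i) => x _ <-; do 2!apply/rz_local_lift;
  apply: rz_local_full.
Qed.

End Joint.
End Model.

(** * Elements isolating a partition *)

Section MatrixUnits.
Variables (C : numClosedFieldType) (P : eqType) (p0 : P).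
Local Notation M := (plfmx C P p0).

Fact matrix_unit_finite (u v : P) :
  locally_finite (fun p q => ((p == u) && (q == v))%:R : C).
Proof.
move=> p; exists [:: u; v] => q;
  rewrite !inE negb_or => /andP[/negPf -> /negPf ->].
by rewrite andbF.
Qed.

Definition matrix_unit (u v : P) : M := LFMx (matrix_unit_finite u v).

Lemma matrix_unit_mul u v (Z : M) p q :
  (matrix_unit u v * Z) p q = (p == u)%:R * Z v q.
Proof.
rewrite (lfmxM_single (r := v)) /= ?eqxx ?andbT // => w /negPf ->.
by rewrite andbF mul0r.
Qed.

Section Chain.
Variables (J : Type) (u v : J -> P).

(** The edges from [u i] to [v i], for i in s, form a path from p to q; this is when the product of
    the matrix units has entry 1 there. *)
Fixpoint chained (p : P) (s : seq J) (q : P) : bool :=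
  if s is i :: s' then (p == u i) && chained (v i) s' q else p == q.

Lemma matrix_unit_prod s p q :
  (\prod_(i <- s) matrix_unit (u i) (v i)) p q = (chained p s q)%:R.
Proof.
elim: s p => [|i s IH] p; first by rewrite big_nil.
by rewrite big_cons matrix_unit_mul IH -natrM mulnb.
Qed.

End Chain.

Section Cycle.
Variables (J : eqType) (e : seq J) (pt : nat -> P).
Hypothesis e_uniq : uniq e.
Hypothesis pt_inj : injective pt.

Let u i := pt (index i e).
Let v i := pt ((index i e).+1 %% size e).

(** Along the cycle a path from point k back to point 0 cannot skip an element of e. The last
    hypothesis excludes the empty path at point 0. *)
Lemma chained_cycle s k : (k < size e)%N -> subseq s (drop k e) ->
  (k = 0%N -> s != [::]) -> chained u v (pt k) s (pt 0) = (s == drop k e).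
Proof.
have dropE l : (l < size e)%N ->
    exists2 x, drop l e = x :: drop l.+1 e & index x e = l.
  case: e e_uniq => // x0 e' ue le; exists (nth x0 (x0 :: e') l).
    exact: drop_nth.
  by rewrite index_uniq.
elim: s k => [|i s IH] k ke; have [x Ex xk] := dropE k ke; rewrite Ex.
  move=> _ k0 /=; apply: contraTF isT => /eqP/pt_inj Ek.
  by have := k0 Ek.
have xe : x \in e by rewrite -index_mem xk.
rewrite /= eqseq_cons; have [-> | ix] := eqVneq i x.
  move=> st _; rewrite /u /v xk eqxx /=.
  have [k1 | k1] := ltnP k.+1 (size e).
    by rewrite modn_small // IH.
  (* At the last element the cycle closes: the successor is point 0 and the remaining word is
     empty. *)
  have Ek : k.+1 = size e by apply/eqP; rewrite eqn_leq ke.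
  by move: st; rewrite Ek modnn drop_size subseq0 => /eqP -> /=; rewrite eqxx.
(* An edge that leaves point k belongs to the element of index k in e, which is x. *)
move=> st _; apply: contraNF ix => /andP[/eqP/pt_inj Ek _].
have ie : i \in e by apply: (mem_drop (n0 := k.+1)); apply: (mem_subseq st);
  rewrite inE eqxx.
by rewrite -(nth_index x ie) -Ek -xk nth_index.
Qed.

End Cycle.
End MatrixUnits.

(** * Increasing enumerations, fibres and partitions *)

Section OrdinalSets.
Variable n : nat.
Implicit Types W V : {set 'I_n}.

Lemma big_enum_set (R : pzRingType) (F : 'I_n -> R) W :
  \prod_(i in W) F i = \prod_(i <- enum W) F i.
Proof. by rewrite -big_filter [index_enum _]unlock. Qed.

Lemma sorted_enum_set W : sorted (relpre val ltn) (enum W).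
Proof.
rewrite /enum_mem -enumT; apply: sorted_filter; first by move=> x y z;
  apply: ltn_trans.
by rewrite -sorted_map val_enum_ord iota_ltn_sorted.
Qed.

Lemma subseq_enum_set W V : W \subset V -> subseq (enum W) (enum V).
Proof.
move=> WV; rewrite (_ : enum W = filter (mem W) (enum V)) ?filter_subseq //.
rewrite /enum_mem -filter_predI; apply: eq_filter => i /=.
by rewrite andb_idr //; apply: (subsetP WV).
Qed.

End OrdinalSets.

Section IncreasingMaps.
Variable n : nat.

Lemma enum_imset_incr m (w : 'I_m -> 'I_n) (U : {set 'I_m}) :
  {homo w : i j / (i < j)%N} -> enum (w @: U) = map w (enum U).
Proof.
move=> wlt; apply: (@irr_sorted_eq _ (relpre val ltn)).
- by move=> x y z; apply: ltn_trans.
- by move=> x; apply: ltnn.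
- exact: sorted_enum_set.
- rewrite sorted_map; move: (sorted_enum_set U); apply: sub_sorted => x y;
  exact: wlt.
move=> i; rewrite mem_enum; apply/imsetP/mapP => -[j jU ->]; exists j => //.
  by rewrite mem_enum.
by rewrite mem_enum in jU.
Qed.

Lemma big_imset_incr (R : pzRingType) m (w : 'I_m -> 'I_n) (U : {set 'I_m})
    (F : 'I_n -> R) :
  {homo w : i j / (i < j)%N} ->
    \prod_(k in U) F (w k) = \prod_(i in w @: U) F i.
Proof.
move=> wlt; rewrite big_enum_set [RHS]big_enum_set.
by rewrite enum_imset_incr // big_map.
Qed.

Lemma enum_val_incr (W : {set 'I_n}) : {homo (fun k : 'I_#|W| =>
  enum_val k) : i j / (i < j)%N}.
Proof.
move=> i j ij; have sz (k : 'I_#|W|) : (k < size (enum W))%N by rewrite -cardE.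
have x0 := enum_val i; rewrite (enum_val_nth x0 i) (enum_val_nth x0 j).
apply: (sorted_ltn_nth (leT := relpre val ltn)) => //.
- by move=> x y z; apply: ltn_trans.
- exact: sorted_enum_set.
- by rewrite inE sz.
- by rewrite inE sz.
Qed.

Lemma imset_enum_val (W : {set 'I_n}) : (fun k : 'I_#|W| =>
  enum_val k) @: [set: 'I_#|W|] = W.
Proof.
apply/setP => i; apply/imsetP/idP => [[k _ ->] | iW]; first exact: enum_valP.
by exists (enum_rank_in iW i); rewrite ?enum_rankK_in.
Qed.

End IncreasingMaps.

Lemma prod_natr_bool (R : comNzRingType) (T : finType) (D : {pred T}) (p :
  pred T) :
  \prod_(x in D) (p x)%:R = [forall x in D, p x]%:R :> R.
Proof.
case: (boolP [forall x in D, p x]) => [/forall_inP pD | ].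
  by apply: big1 => x /pD ->.
rewrite negb_forall_in => /exists_inP[x xD /negPf px].
by rewrite (bigD1 x) //= px mul0r.
Qed.

Definition fibre_constant (I : finType) (K J : eqType) (b : I -> K) (j : I ->
  J) :
    bool :=
  [forall x, forall y, (b x == b y) ==> (j x == j y)].

(** The maps counted are the compositions of b with an arbitrary map from its image to ['I_N]. *)
Lemma card_fibre_constant (I K : finType) (b : I -> K) (N : nat) :
  #|[pred j : {ffun I -> 'I_N} | fibre_constant b j]| =
    (N ^ #|b @: [set: I]|)%N.
Proof.
pose S : finType := {k : K | k \in b @: [set: I]}.
pose bS i : S := exist _ (b i) (imset_f b (in_setT i)).
have surj (s : S) : exists i, bS i == s.
  by case: s => k kb; case/imsetP: (kb) => i _ Ek; exists i; apply/eqP/val_inj.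
pose F (g : {ffun S -> 'I_N}) : {ffun I -> 'I_N} := [ffun i => g (bS i)].
have F_inj : injective F.
  move=> g g' /ffunP E; apply/ffunP => s; case: (surj s) => i /eqP <-.
  by have := E i; rewrite !ffunE.
rewrite (_ : N ^ _ = #|F @: [set: {ffun S -> 'I_N}]|)%N; last first.
  rewrite [RHS]card_imset // cardsT card_ffun card_ord card_sig;
    congr (_ ^ _)%N.
apply: eq_card => j; rewrite !inE; apply/idP/imsetP => [cst | [g _ ->]].
  exists [ffun s => j (xchoose (surj s))]; rewrite ?inE //.
  apply/ffunP => i; rewrite !ffunE; apply/eqP.
  have /eqP/(congr1 val) /= Eb := xchooseP (surj (bS i)).
  have /forallP/(_ (xchoose (surj (bS i))))/forallP/(_ i) := cst.
  by rewrite Eb eqxx /= eq_sym.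
apply/forallP => x; apply/forallP => y; apply/implyP => /eqP Eb.
by rewrite !ffunE (_ : bS x = bS y) //; apply: val_inj.
Qed.

Section Partitions.
Variables (T : finType) (D : {set T}).

(** A block of Q shares a point with some block of P, which is again a block of Q; blocks of Q
    through one point coincide. *)
Lemma partition_sub_eq (P Q : {set {set T}}) :
  partition P D -> partition Q D -> P \subset Q -> P = Q.
Proof.
move=> hP hQ PQ; apply/eqP; rewrite eqEsubset PQ; apply/subsetP => U UQ.
have /and3P[/eqP covP trP _] := hP; have /and3P[/eqP covQ trQ Q0] := hQ.
have [x xU] : exists x, x \in U.
  by apply/set0Pn; apply: contraNneq Q0 => <-.
have xP : x \in cover P by rewrite covP -covQ; apply/bigcupP; exists U.
have xB : x \in pblock P x by rewrite mem_pblock.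
rewrite -(def_pblock trQ UQ xU) (def_pblock trQ (subsetP PQ _ (pblock_mem xP))
  xB).
exact: pblock_mem.
Qed.

End Partitions.

Section FibrePartition.
Variables (m : nat) (K : eqType) (b : 'I_m -> K).
Local Notation rho := (preim_partition b [set: 'I_m]).

Lemma preim_partition_setT : is_partition rho.
Proof. exact: preim_partitionP. Qed.

Lemma mem_pblock_preim x y : (y \in pblock rho x) = (b x == b y).
Proof.
rewrite pblock_equivalence_partition ?inE //.
by split=> // /eqP ->.
Qed.

Lemma mem_preim_partition (U : {set 'I_m}) x :
  (forall y, (y \in U) = (b x == b y)) -> U \in rho.
Proof.
move=> hU; have /and3P[/eqP cov _ _] := preim_partition_setT.
rewrite (_ : U = pblock rho x); first by rewrite pblock_mem // cov inE.
by apply/setP => y; rewrite hU mem_pblock_preim.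
Qed.

Lemma preim_partition_block (U : {set 'I_m}) x y :
  U \in rho -> x \in U -> (y \in U) = (b x == b y).
Proof.
have /and3P[_ tr _] := preim_partition_setT.
by move=> Urho xU; rewrite -mem_pblock_preim (def_pblock tr Urho xU).
Qed.

End FibrePartition.

Lemma block_moment_const (C : numClosedFieldType) (I : finType) (A : probSpace
  C)
    (m : nat) (X : 'I_m -> {k : I & A}) (U : {set 'I_m}) :
  U != set0 -> {in U &, forall k l, tag (X k) = tag (X l)} ->
  @block_moment C I (fun _ => A) m X U = ps_state (\prod_(k in U) tagged (X k)).
Proof.
move=> U0 eqU; rewrite /block_moment; case: pickP => [k0 k0U | U_0]; last first.
  by case/set0Pn: U0 => k; rewrite U_0.
(* [untag] transports along an equality of tags; the family is constant, so the transport is the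
   identity. *)
congr ps_state; apply: eq_bigr => k kU; have e := eqU _ _ kU k0U.
by rewrite (untagE _ _ e); case: (X k) e => t x /= e; case: _ / e.
Qed.

Section CycleElements.
Variables (C : numClosedFieldType) (ty : independence) (rz : realization C ty).
Variables (n : nat) (pi : {set {set 'I_n}}).
Hypothesis hpi : is_partition pi.
Local Notation T := (rz_space rz unit).

Lemma mem_pblockT i : i \in pblock pi i.
Proof. by have /and3P[/eqP cov _ _] := hpi; rewrite mem_pblock cov inE. Qed.

Lemma pblock_memT i : pblock pi i \in pi.
Proof. by have /and3P[/eqP cov _ _] := hpi; rewrite pblock_mem // cov inE. Qed.

Lemma pblock_eqT V i : V \in pi -> i \in V -> pblock pi i = V.
Proof. by have /and3P[_ tr _] := hpi; apply: def_pblock. Qed.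

(** In increasing order, the m elements of a block receive e_(0,1), ..., e_(m-1,0), where point 0 is
    the vacuum. A singleton block receives e_(0,0). *)
Definition cycle_elt (i : 'I_n) : T :=
  let e := enum (pblock pi i) in
  matrix_unit C (rz_vac rz unit)
    (rz_nth rz (index i e)) (rz_nth rz ((index i e).+1 %% size e)).

Lemma cycle_moment (V W : {set 'I_n}) : V \in pi -> W \subset V -> W != set0 ->
  ps_state (\prod_(i in W) cycle_elt i) = (W == V)%:R.
Proof.
move=> Vpi WV W0; rewrite big_enum_set.
have -> : \prod_(i <- enum W) cycle_elt i = \prod_(i <- enum W)
    matrix_unit C (rz_vac rz unit) (rz_nth rz (index i (enum V)))
      (rz_nth rz ((index i (enum V)).+1 %% size (enum V))).
  apply: eq_big_seq => i; rewrite mem_enum => /(subsetP WV) iV.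
  by rewrite /cycle_elt (pblock_eqT Vpi iV).
rewrite /= /vacuum matrix_unit_prod -rz_nth0 chained_cycle ?drop0 ?enum_uniq //.
- congr ((nat_of_bool _)%:R); apply/eqP/eqP => [E | -> //].
  by apply/setP => i; rewrite -mem_enum E mem_enum.
- exact: rz_nth_inj.
- by rewrite -cardE; apply/card_gt0P; case/set0Pn: W0 => i /(subsetP WV);
  exists i.
- exact: subseq_enum_set.
- by move=> _; rewrite -size_eq0 -cardE cards_eq0.
Qed.

Section Word.
Variable c : forall n, {set {set 'I_n}} -> {set {set 'I_n}} -> C.
Hypothesis hc : universal_coefficients ty c.
Variables (m : nat) (w : 'I_m -> 'I_n).
Hypothesis m_gt0 : (0 < m)%N.
Hypothesis w_incr : {homo w : i j / (i < j)%N}.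

Let b k := pblock pi (w k).
Let rho := preim_partition b [set: 'I_m].

(** The letters of the word form a union of blocks of [pi]: each block that is met is met
    entirely. *)
Definition saturated : bool := [forall U in rho, w @: U \in pi].

Lemma w_inj : injective w.
Proof.
move=> i j Ew; apply: val_inj.
by case: (ltngtP (val i) (val j)) => // /w_incr; rewrite Ew ltnn.
Qed.

(** A set of positions whose image is a whole block of [pi] is a full fibre of [b], by injectivity
    of [w]. *)
Lemma partition_in_pi (sigma : {set {set 'I_m}}) :
  is_partition sigma -> [forall U in sigma, w @: U \in pi] -> sigma = rho.
Proof.
move=> hs /forall_inP good;
  have hr : is_partition rho by exact: preim_partition_setT.
apply: (partition_sub_eq hs hr); apply/subsetP => U Us.
have /and3P[_ _ s0] := hs.
have [x xU] : exists x, x \in U by apply/set0Pn; apply: contraNneq s0 => <-.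
apply: (mem_preim_partition (x := x)) => y.
rewrite /b (pblock_eqT (good U Us) (imset_f w xU)); apply/idP/eqP => [yU | E].
  by rewrite (pblock_eqT (good U Us) (imset_f w yU)).
by have := mem_pblockT (w y); rewrite -E mem_imset //; apply: w_inj.
Qed.

Variable N : nat.
Local Notation lab := (fun l : {set 'I_n} * 'I_N => (l.1, val l.2)).

Lemma lab_inj : injective lab.
Proof. by move=> [V j] [V' j'] /= [-> /val_inj ->]. Qed.

(** In the universal expansion for the labels (b k, j k) only [rho] can have a nonzero moment. It is
    admissible only if j is constant on the fibres of [b], and then the label partition is [rho]
    too, which leaves a highest coefficient. *)
Lemma word_moment (j : 'I_m -> 'I_N) :
  ps_state (\prod_(k < m) copy_map (rz := rz) (j k)
     (letter_map (b k) (cycle_elt (w k)))) =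
  if saturated && fibre_constant b j then c rho rho else 0.
Proof.
(* Universal products have finite index types, hence copy numbers in ['I_N]. *)
pose L : finType := ({set 'I_n} * 'I_N)%type.
pose X k : {l : L & T} := existT (fun _ : L =>
  T : Type) (b k, j k) (cycle_elt (w k)).
pose kap := preim_partition (fun k => (b k, j k)) [set: 'I_m].
have hk : is_partition kap := preim_partition_setT _.
have hX : @in_blocks C L (fun _ => T) m kap X.
  by move=> x y; rewrite mem_pblock_preim.
have Dlin : scalar (@ps_state C (rz_space rz ({set 'I_n} * nat)%type)).
  by case: (ps_stateP (rz_space rz ({set 'I_n} * nat)%type)).
have := universal_formula (@joint_map_hom _ _ rz _ _ lab) Dlin
  (@joint_map_state _ _ rz _ _ lab)
  (joint_map_indep rz lab_inj) hc m_gt0 hk hX.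
rewrite /joint_map /= => ->.
(* Each block of sigma carries one label, so its image lies in one block of [pi], and [cycle_moment]
   makes its factor 1 or 0. *)
have momE sigma : is_partition sigma && refines sigma kap ->
    moment_part sigma X = [forall U in sigma, w @: U \in pi]%:R.
  move=> /andP[/and3P[_ _ s0] /forall_inP ref].
  rewrite -prod_natr_bool; apply: eq_bigr => U Us.
  have U0 : U != set0 by apply: contraNneq s0 => <-.
  have /exists_inP[V Vk UV] := ref U Us.
  have tagE : {in U &, forall k l, tag (X k) = tag (X l)}.
    move=> k l /(subsetP UV) kV /(subsetP UV) lV; apply/eqP.
    by rewrite -(preim_partition_block l Vk kV).
  rewrite (block_moment_const U0 tagE) (big_imset_incr U cycle_elt w_incr).
  have /set0Pn[k kU] := U0.
  rewrite (cycle_moment (pblock_memT (w k))).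
  - congr ((nat_of_bool _)%:R); apply/eqP/idP => [-> | wU];
    first exact: pblock_memT.
    by rewrite (pblock_eqT wU) // imset_f.
  - apply/subsetP => _ /imsetP[l lU ->]; have := tagE _ _ kU lU => -[Ekl _].
    by rewrite -/(b k) Ekl mem_pblockT.
  - by apply/set0Pn; exists (w k); apply: imset_f.
under eq_bigr => sigma hs do rewrite momE //.
have hr : is_partition rho := preim_partition_setT b.
case: ifP => [/andP[sat /forallP cst] | nsat].
  have satE : [forall U in rho, w @: U \in pi] = true := sat.
  have Ek : kap = rho.
    apply: eq_imset => x; apply/setP => y; rewrite !inE /= xpair_eqE.
    by have /forallP/(_ y) := cst x; case: (b x == b y).
  have ref : refines rho rho by apply/forall_inP => U Us; apply/exists_inP;
    exists U.
  rewrite Ek (bigD1 rho) /= ?hr ?ref // satE mulr1.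
  rewrite big1 ?addr0 // => sigma /andP[/andP[hs _] ns].
  case: (boolP [forall U in _, _]) => [/(partition_in_pi hs) E | _];
    last by rewrite mulr0.
  by rewrite E eqxx in ns.
apply: big1 => sigma /andP[hs ref].
case: (boolP [forall U in _, _]) => [good | _]; last by rewrite mulr0.
have Es := partition_in_pi hs good; rewrite Es in good ref.
(* Since [rho] refines the label partition, positions with equal [b] have equal j, against the
   failed condition. *)
case/negP: nsat; rewrite /saturated good /=; apply/forallP => x;
  apply/forallP => y; apply/implyP => bxy.
have /and3P[/eqP cov _ _] := hr.
have := forall_inP ref (pblock rho x);
  rewrite pblock_mem ?cov ?inE // => /(_ isT).
move=> /exists_inP[V Vk sub].
have := preim_partition_block y Vk (subsetP sub x _).
rewrite mem_pblock_preim eqxx => /(_ isT).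
by rewrite (subsetP sub) ?mem_pblock_preim // xpair_eqE => /esym/andP[].
Qed.

End Word.
End CycleElements.

(** * Cumulants *)

(** If p - q were nonzero, the natural numbers below its size would already be too many roots. *)
Lemma poly_eq_on_nat (R : numDomainType) (p q : {poly R}) :
  (forall N : nat, p.[N%:R] = q.[N%:R]) -> p = q.
Proof.
move=> E; apply/eqP; rewrite -subr_eq0; apply: contraT => pq0.
have := @max_poly_roots _ (p - q) [seq N%:R | N <- iota 0 (size (p - q)%R)] pq0.
rewrite size_map size_iota ltnn => -> //.
  by apply/allP => _ /mapP[N _ ->]; rewrite rootE hornerD hornerN E subrr.
by rewrite map_inj_uniq ?iota_uniq // => i j /eqP; rewrite eqr_nat => /eqP.
Qed.

(** The polynomial is determined by its values at natural numbers, so any one that interpolates the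
    moments gives the value selected by [xget]. *)
Lemma cumulantE (C : numClosedFieldType) ty (A : probSpace C) (E : copies ty A)
    (n : nat) (X : 'I_n -> A) (p : {poly C}) :
  (forall N : nat, ps_state (\prod_(i < n) dot E N (X i)) = p.[N%:R]) ->
  cumulant E X = p`_1.
Proof.
move=> hp; apply: xget_unique; first by exists p.
move=> _ [q [hq ->]]; suff -> : q = p by []; apply: poly_eq_on_nat => N.
by rewrite -hq hp.
Qed.

Lemma ps_state_sum (C : numClosedFieldType) (A : probSpace C) (I : Type)
    (r : seq I) (P : pred I) (F : I -> A) :
  ps_state (\sum_(i <- r | P i) F i) = \sum_(i <- r | P i) ps_state (F i).
Proof.
have [lin _ _] := ps_stateP A.
have D x y : ps_state (x + y : A) = ps_state x + ps_state y.
  by have := lin 1 x y; rewrite scale1r mul1r.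
apply: (big_morph _ D).
by apply: (addrI (ps_state (0 : A))); rewrite -D !addr0.
Qed.

Lemma dot_moment (C : numClosedFieldType) ty (A : probSpace C) (E : copies ty A)
    (n N : nat) (X : 'I_n -> A) :
  ps_state (\prod_(i < n) dot E N (X i)) =
  \sum_(j : {ffun 'I_n -> 'I_N}) ps_state (\prod_(i < n) cp_map E (j i) (X i)).
Proof.
by rewrite -ps_state_sum /dot (bigA_distr_bigA (fun i (j : 'I_N) =>
  cp_map E j (X i))).
Qed.

Section Cumulants.
Variables (C : numClosedFieldType) (ty : independence) (rz : realization C ty).
Variables (n : nat) (pi : {set {set 'I_n}}).
Hypothesis hpi : is_partition pi.
Variable c : forall n, {set {set 'I_n}} -> {set {set 'I_n}} -> C.
Hypothesis hc : universal_coefficients ty c.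

Definition block_elt (i : 'I_n) : rz_space rz {set 'I_n} :=
  letter_map (pblock pi i) (cycle_elt rz pi i).

Section Word.
Variables (m : nat) (w : 'I_m -> 'I_n).
Hypothesis m_gt0 : (0 < m)%N.
Hypothesis w_incr : {homo w : i j / (i < j)%N}.
Local Notation b := (fun k => pblock pi (w k)).
Local Notation rho := (preim_partition b [set: 'I_m]).

(** For a saturated word, the choices of copies constant on the fibres contribute equally and the
    others vanish. The moment is a monomial in N whose exponent is the number of blocks met, so it
    is linear only for one block. *)
Lemma cumulant_word :
  cumulant (rz_copies rz {set 'I_n}) (fun k => block_elt (w k)) =
  if saturated pi w && (#|b @: [set: 'I_m]| == 1%N) then c rho rho else 0.
Proof.
rewrite (cumulantE (p := (if saturated pi w then c rho rho else 0) *: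
                         'X^#|b @: [set: 'I_m]|)).
  by rewrite coefZ coefXn [1%N == _]eq_sym; case: saturated; case: eqP;
    rewrite ?mul0r ?mulr0 ?mulr1.
move=> N; rewrite dot_moment hornerZ hornerXn -natrX -card_fibre_constant.
rewrite (eq_bigr (fun j : {ffun 'I_m -> 'I_N} =>
  if saturated pi w && fibre_constant b j then c rho rho else 0)); last first.
  by move=> j _; apply: word_moment.
case: saturated => /=; last by rewrite big1 ?mul0r.
by rewrite -big_mkcond sumr_const mulr_natr.
Qed.

End Word.

Lemma cumulant_block (W : {set 'I_n}) : W != set0 ->
  cumulant (rz_copies rz {set 'I_n}) (fun k : 'I_#|W| =>
    block_elt (enum_val k)) =
  (W \in pi)%:R.
Proof.
move=> W0; have m_gt0 : (0 < #|W|)%N by rewrite card_gt0.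
pose w (k : 'I_#|W|) := enum_val k; pose b k := pblock pi (w k).
have w_incr : {homo w : i j / (i < j)%N} by exact: enum_val_incr.
have wT : w @: [set: 'I_#|W|] = W by exact: imset_enum_val.
pose k0 := Ordinal m_gt0; pose rho := preim_partition b [set: 'I_#|W|].
rewrite (cumulant_word m_gt0 w_incr) -/rho.
have [Wpi | nW] := boolP (W \in pi); last first.
  (* With a single fibre, that fibre is the whole word, and saturation puts its image [W] in
     [pi]. *)
  case: ifP => // /andP[/forall_inP sat /cards1P[V bV]].
  case/negP: nW; rewrite -wT; apply: sat.
  apply: (mem_preim_partition (x := k0)) => y; rewrite inE.
  have bE k : b k = V by apply/set1P; rewrite -bV imset_f.
  by rewrite -/(b k0) -/(b y) !bE eqxx.
have bE k : b k = W by apply: pblock_eqT => //; apply: enum_valP.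
have sat : saturated pi w.
  apply/forall_inP => U Urho; rewrite (_ : U = setT) ?wT //.
  have /and3P[_ _ r0] := preim_partition_setT b.
  have [x xU] : exists x, x \in U by apply/set0Pn; apply: contraNneq r0 => <-.
  by apply/setP => y; rewrite inE (preim_partition_block y Urho xU) -/(b x)
    -/(b y) !bE eqxx.
(* The value of [c rho rho] comes from one copy, N = 1: the same moment is [c rho rho] by
   [word_moment] and 1 by [cycle_moment]. *)
have := word_moment rz hpi hc m_gt0 w_incr (fun _ => ord0 : 'I_1).
have -> : fibre_constant b (fun _ => ord0 : 'I_1).
  by apply/forallP => x; apply/forallP => y; rewrite eqxx implybT.
have -> : #|b @: [set: 'I_#|W|]| == 1%N.
  by apply/cards1P; exists W; apply/setP => V; rewrite inE;
    apply/imsetP/eqP => [[k _ ->] | ->];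
    [exact: bE | exists k0; rewrite ?bE].
rewrite sat /= => <-.
under eq_bigr => k _ do rewrite -/(b k) bE.
rewrite -(star_hom_prod _ (copy_map_hom rz {set 'I_n} 0)) //.
rewrite -(star_hom_prod _ (rz_lift_hom rz (point_alphabet W))) //.
rewrite !rz_lift_vacuum.
have := cycle_moment rz hpi Wpi (subxx W) W0.
rewrite eqxx -{1}wT -(big_imset_incr _ _ w_incr) => cm.
by apply: etrans cm; congr vacuum; apply: eq_bigl => k; rewrite inE.
Qed.

End Cumulants.

(** * Comparison of the two expansions *)

Lemma moment_block_elt (C : numClosedFieldType) (ty : independence)
    (rz : realization C ty)
    (c : forall n, {set {set 'I_n}} -> {set {set 'I_n}} -> C)
    (n : nat) (pi : {set {set 'I_n}}) :
  universal_coefficients ty c -> (0 < n)%N -> is_partition pi ->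
  ps_state (\prod_(i < n) block_elt rz pi i) = c n pi pi.
Proof.
(* Passing to copy 0 gives the word of all letters with N = 1, whose fibre partition is [pi]
   itself. *)
move=> hc n_gt0 hpi; rewrite -(copy_map_moments 0).
have id_incr : {homo (@id 'I_n) : i j / (i < j)%N} by [].
have id_pi : [forall U in pi, id @: U \in pi].
  by apply/forall_inP => U Upi; rewrite imset_id.
have rhoE := partition_in_pi hpi id_incr hpi id_pi.
have sat : saturated pi id by rewrite /saturated -rhoE.
have := word_moment rz hpi hc n_gt0 id_incr (fun _ => ord0 : 'I_1).
rewrite sat -rhoE (_ : fibre_constant _ _ = true) //.
by apply/forallP => x; apply/forallP => y; rewrite eqxx implybT.
Qed.

(** A product of indicators of V in [pi], over the blocks V of [tau], is 1 only if all these blocks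
    lie in [pi], and then the two partitions coincide. *)
Lemma prod_cumulant_block (C : numClosedFieldType) (ty : independence)
    (rz : realization C ty)
    (c : forall n, {set {set 'I_n}} -> {set {set 'I_n}} -> C)
    (n : nat) (pi tau : {set {set 'I_n}}) :
  universal_coefficients ty c -> is_partition pi -> is_partition tau ->
  cumulant_part (rz_copies rz {set 'I_n}) tau (block_elt rz pi) =
  (tau == pi)%:R.
Proof.
move=> hc hpi htau; have /and3P[_ _ tau0] := htau.
rewrite /cumulant_part.
under eq_bigr => V Vtau.
  rewrite (cumulant_block rz hpi hc); last by apply: contraNneq tau0 => <-.
  over.
rewrite prod_natr_bool; congr ((nat_of_bool _)%:R).
apply/forall_inP/eqP => [sub | -> //].
by apply: (partition_sub_eq htau hpi); apply/subsetP.
Qed.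

Lemma highest_coefficient (C : numClosedFieldType) (ty : independence)
    (c : forall n, {set {set 'I_n}} -> {set {set 'I_n}} -> C)
    (d : forall n, {set {set 'I_n}} -> C) (n : nat) (pi : {set {set 'I_n}}) :
  universal_coefficients ty c -> moment_cumulant_coefficients ty d ->
  (0 < n)%N -> is_partition pi -> d n pi = c n pi pi.
Proof.
move=> hc hd n_gt0 hpi; pose rz := realization_of C ty.
rewrite -(moment_block_elt rz hc n_gt0 hpi).
rewrite (hd _ (rz_copies rz {set 'I_n}) n (block_elt rz pi) n_gt0).
rewrite (bigD1 pi) //= (prod_cumulant_block rz hc) // eqxx mulr1.
rewrite big1 ?addr0 // => tau /andP[htau /negPf ntau].
by rewrite (prod_cumulant_block rz hc) // ntau mulr0.
Qed.

Theorem theorem4p3 (R : realType) (ty : independence)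
    (c : forall n : nat, {set {set 'I_n}} -> {set {set 'I_n}} -> R[i])
    (d : forall n : nat, {set {set 'I_n}} -> R[i])
    (hc : universal_coefficients ty c)
    (hd : moment_cumulant_coefficients ty d)
    (n : nat) (hn : (1 <= n)%N)
    (pi : {set {set 'I_n}}) (hpi : is_partition pi) :
  d n pi = c n pi pi.
Proof. exact: highest_coefficient hc hd hn hpi. Qed.
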